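(* Let $R$ be a real closed field and let $F$ be a proper subfield of $R$. Let $E(\vec x,\vec y)$ be a semialgebraic predicate and $h_1(\vec x,\vec y),\ldots,h_m(\vec x,\vec y)$ semialgebraic functions on $R$, where $\vec x=(x_1,\ldots,x_n)$. Then the formula $$\exists x_1\notin F\,\cdots\,\exists x_n\notin F\;\bigl(E(\vec x,\vec y)\wedge h_1(\vec x,\vec y)\notin F\wedge\cdots\wedge h_m(\vec x,\vec y)\notin F\bigr)$$ is equivalent in $R$ (for all $\vec y$) to a positive boolean combination of assertions of the form $D(\vec y)$ and $g(\vec y)\notin F$, where the $D$ and $g$ are semialgebraic. Moreover, there is an algorithm which computes such an expression (presentations of the $D$'s and $g$'s) from presentations of $E,h_1,\ldots,h_m$, and this algorithm does not depend on $R$ or $F$.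
   Context: A function $h(\vec x)$ or predicate $E(\vec x)$ on a real closed field $R$ is semialgebraic if it is definable in $R$ in the language of real closed fields (ordered fields) without parameters; a presentation is such a defining formula. A positive boolean combination is one built using only $\wedge$ and $\vee$. *)

(* Defs.v *)
From mathcomp Require Import all_boot all_order all_algebra.
Set Implicit Arguments.
Unset Strict Implicit.
Unset Printing Implicit Defensive.
Import Order.TTheory GRing.Theory Num.Theory.
Local Open Scope ring_scope.

Inductive oterm : Type :=
  | TVar of nat
  | TZero
  | TOne
  | TAdd of oterm & oterm
  | TOpp of oterm
  | TMul of oterm & oterm.

Inductive oformula : Type :=
  | FTrue
  | FFalse
  | FEq of oterm & oterm
  | FLt of oterm & oterm
  | FNot of oformula
  | FAnd of oformula & oformula
  | FOr of oformula & oformula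
  | FImp of oformula & oformula
  | FEx of nat & oformula
  | FAll of nat & oformula.

Section Semantics.
Variable R : rcfType.

Fixpoint eval_term (e : seq R) (t : oterm) : R :=
  match t with
  | TVar i => nth 0 e i
  | TZero => 0
  | TOne => 1
  | TAdd t1 t2 => eval_term e t1 + eval_term e t2
  | TOpp t1 => - eval_term e t1
  | TMul t1 t2 => eval_term e t1 * eval_term e t2
  end.

Fixpoint holds (e : seq R) (f : oformula) : Prop :=
  match f with
  | FTrue => True
  | FFalse => False
  | FEq t1 t2 => eval_term e t1 = eval_term e t2
  | FLt t1 t2 => eval_term e t1 < eval_term e t2
  | FNot g => ~ holds e g
  | FAnd g1 g2 => holds e g1 /\ holds e g2
  | FOr g1 g2 => holds e g1 \/ holds e g2
  | FImp g1 g2 => holds e g1 -> holds e g2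
  | FEx i g => exists v : R, holds (set_nth 0 e i v) g
  | FAll i g => forall v : R, holds (set_nth 0 e i v) g
  end.

(* A formula [g] presents a (total) semialgebraic function R^k -> R when,
   for every argument tuple [v], there is exactly one [z] with
   [holds (v ++ [:: z]) g] (variables 0..k-1 are the arguments, variable k
   is the value).  A formula [D] presents the semialgebraic predicate
   [v |-> holds v D] on R^k. *)
Definition presents_function (k : nat) (g : oformula) : Prop :=
  forall v : k.-tuple R, exists! z : R, holds (v ++ [:: z]) g.

Definition fun_notin (F : R -> Prop) (v : seq R) (g : oformula) : Prop :=
  exists z : R, holds (v ++ [:: z]) g /\ ~ F z.

Definition is_subfield (F : R -> Prop) : Prop :=
  F 0 /\ F 1 /\
  (forall a b, F a -> F b -> F (a + b)) /\
  (forall a, F a -> F (- a)) /\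
  (forall a b, F a -> F b -> F (a * b)) /\
  (forall a, F a -> a != 0 -> F a^-1).

Definition proper_subfield (F : R -> Prop) : Prop :=
  is_subfield F /\ exists r : R, ~ F r.

End Semantics.

Inductive pbc : Type :=
  | PD of oformula
  | PG of oformula
  | PAnd of pbc & pbc
  | POr of pbc & pbc.

Fixpoint pbc_holds (R : rcfType) (F : R -> Prop) (y : seq R) (p : pbc) : Prop :=
  match p with
  | PD D => holds y D
  | PG g => fun_notin F y g
  | PAnd p1 p2 => pbc_holds F y p1 /\ pbc_holds F y p2
  | POr p1 p2 => pbc_holds F y p1 \/ pbc_holds F y p2
  end.

Fixpoint pbc_wf (R : rcfType) (k : nat) (p : pbc) : Prop :=
  match p with
  | PD _ => True
  | PG g => presents_function R k g
  | PAnd p1 p2 => pbc_wf R k p1 /\ pbc_wf R k p2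
  | POr p1 p2 => pbc_wf R k p1 /\ pbc_wf R k p2
  end.

(* Main.v *)
(* One variable is eliminated at a time. Fix the parameters y, write E and h_i
   for the resulting set and functions of x, and call h "constant" or "nowhere
   constant" on an open interval when it is so there, resp. on none of its
   subintervals. Either x is one of the finitely many points of E having no
   neighbourhood inside E on which every h_i is constant or nowhere constant,
   and then x is a semialgebraic function of y; or E contains an interval on
   which each h_i is nowhere constant or equal to a c_i outside F, and c_i is
   one of the finitely many locally constant values of h_i, hence again a
   semialgebraic function of y. Quantifier elimination bounds the number of
   these points and values uniformly in R and y, because the shape of the
   quantifier-free formula (all but its constants) does not depend on R.

   Conversely, nowhere constant semialgebraic functions h_1, ..., h_m on an
   interval avoid F simultaneously at some x. Let Q be a minimal polynomial with
   Q(x, h(x)) = 0 on a subinterval. If h(x0 + t w) lies in F for infinitely many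
   t in F, then the coefficients of Q(x0 + t w, z), suitably normalized, lie in
   F: otherwise applying to them an F-linear functional that kills 1 would give
   a smaller polynomial vanishing on the graph of h. Comparing the two leading
   coefficients in x of a non-constant coefficient of Q yields
   (x0 + s) / w in F for some s depending only on Q, and this is easily avoided
   for all h_i at once by the choice of x0 and w. *)
Require Import Defs.
From mathcomp Require Import all_boot all_order all_algebra.
From mathcomp Require Import ring lra zify.
From mathcomp Require polyrcf ordered_qelim qe_rcf_th qe_rcf.
From Stdlib Require Import Classical ClassicalEpsilon.
From Stdlib Require List.
Set Implicit Arguments.
Unset Strict Implicit.
Unset Printing Implicit Defensive.
Import Order.TTheory GRing.Theory Num.Theory.
Local Open Scope ring_scope.

Module Q := qe_rcf.
Module O := ordered_qelim.ord.

(** * Quantifier elimination commutes with erasing constants *)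

(** Replacing every constant by [tt] puts terms over different fields into one type, where having
    the same shape is a plain equality. *)
Fixpoint term_shape (R : Type) (t : GRing.term R) : GRing.term unit :=
  match t with
  | GRing.Var i => GRing.Var _ i
  | GRing.Const _ => GRing.Const tt
  | GRing.NatConst n => GRing.NatConst _ n
  | GRing.Add u v => GRing.Add (term_shape u) (term_shape v)
  | GRing.Opp u => GRing.Opp (term_shape u)
  | GRing.NatMul u n => GRing.NatMul (term_shape u) n
  | GRing.Mul u v => GRing.Mul (term_shape u) (term_shape v)
  | GRing.Inv u => GRing.Inv (term_shape u)
  | GRing.Exp u n => GRing.Exp (term_shape u) n
  end.

Fixpoint formula_shape (R : Type) (f : O.formula R) : O.formula unit :=
  match f with
  | O.Bool b => O.Bool b
  | O.Equal t u => O.Equal (term_shape t) (term_shape u)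
  | O.Lt t u => O.Lt (term_shape t) (term_shape u)
  | O.Le t u => O.Le (term_shape t) (term_shape u)
  | O.Unit t => O.Unit (term_shape t)
  | O.And f g => O.And (formula_shape f) (formula_shape g)
  | O.Or f g => O.Or (formula_shape f) (formula_shape g)
  | O.Implies f g => O.Implies (formula_shape f) (formula_shape g)
  | O.Not f => O.Not (formula_shape f)
  | O.Exists i f => O.Exists i (formula_shape f)
  | O.Forall i f => O.Forall i (formula_shape f)
  end.

Fixpoint rterm_shape (R : Type) (t : Q.term R) : Q.term unit :=
  match t with
  | Q.Var i => Q.Var _ i
  | Q.Const _ => Q.Const tt
  | Q.NatConst n => Q.NatConst _ n
  | Q.Add u v => Q.Add (rterm_shape u) (rterm_shape v)
  | Q.Opp u => Q.Opp (rterm_shape u)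
  | Q.NatMul u n => Q.NatMul (rterm_shape u) n
  | Q.Mul u v => Q.Mul (rterm_shape u) (rterm_shape v)
  | Q.Exp u n => Q.Exp (rterm_shape u) n
  end.

Fixpoint qf_shape (R : Type) (f : Q.formula R) : Q.formula unit :=
  match f with
  | Q.Bool b => Q.Bool b
  | Q.Equal t u => Q.Equal (rterm_shape t) (rterm_shape u)
  | Q.Lt t u => Q.Lt (rterm_shape t) (rterm_shape u)
  | Q.Le t u => Q.Le (rterm_shape t) (rterm_shape u)
  | Q.And f g => Q.And (qf_shape f) (qf_shape g)
  | Q.Or f g => Q.Or (qf_shape f) (qf_shape g)
  | Q.Implies f g => Q.Implies (qf_shape f) (qf_shape g)
  | Q.Not f => Q.Not (qf_shape f)
  end.

Lemma term_shape_rterm (R : Type) (t : Q.term R) :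
  term_shape (Q.rterm_to_term t) = Q.rterm_to_term (rterm_shape t).
Proof. by elim: t => //= [t -> u ->|t ->|t -> n|t -> u ->|t -> n]. Qed.

Lemma formula_shape_qf (R : Type) (f : Q.formula R) :
  formula_shape (Q.qfr_to_formula f) = Q.qfr_to_formula (qf_shape f).
Proof.
by elim: f => //= [t u|t u|t u|f -> g ->|f -> g ->|f -> g ->|f ->];
  rewrite ?term_shape_rterm.
Qed.

Lemma to_rterm_shape (R : Type) (t : GRing.term R) :
  rterm_shape (Q.to_rterm t) = Q.to_rterm (term_shape t).
Proof. by elim: t => //= [t -> u ->|t ->|t -> n|t -> u ->|t -> n]. Qed.

(** * Shape invariance of the projection step, written in continuation-passing style *)

Section ProjShape.
Variables F1 F2 : realFieldType.

Definition polyF_shape (R : realFieldType) (p : Q.polyF R) := map (@rterm_shape R) p.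
Definition polysF_shape (R : realFieldType) (s : seq (Q.polyF R)) :=
  map (@polyF_shape R) s.

Local Notation "x ~t y" := (rterm_shape x = rterm_shape y) (at level 70).
Local Notation "x ~f y" := (qf_shape x = qf_shape y) (at level 70).
Local Notation "x ~p y" := (polyF_shape x = polyF_shape y) (at level 70).
Local Notation "x ~s y" := (polysF_shape x = polysF_shape y) (at level 70).

Lemma shape_If (f g h : Q.formula F1) (f' g' h' : Q.formula F2) :
  f ~f f' -> g ~f g' -> h ~f h' -> Q.If f g h ~f Q.If f' g' h'.
Proof. by rewrite /Q.If /= => -> -> ->. Qed.

(** The size of a symbolic polynomial is found by case distinctions inside the formula, so both
    continuations receive the same number [n]. The procedure never branches on a constant itself;
    hence, here and below, related data and related continuations give related formulas. *)
Lemma shape_Size (p : Q.polyF F1) (p' : Q.polyF F2) k k' : p ~p p' -> (forall n, k n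
    ~f k' n) ->
  Q.Size p k ~f Q.Size p' k'.
Proof.
elim: p p' k k' => [|t p IH] [|t' p'] k k' //= [et ep] kk; rewrite /Q.bind_def.
by apply: IH => // -[|n] //; apply: shape_If => //=; rewrite et.
Qed.

Lemma shape_Isnull (p : Q.polyF F1) (p' : Q.polyF F2) k k' : p ~p p' -> (forall n, k n
    ~f k' n) ->
  Q.Isnull p k ~f Q.Isnull p' k'.
Proof. by move=> ep kk; apply: shape_Size. Qed.

Lemma shape_LtSize (p : Q.polyF F1) (p' : Q.polyF F2) (q : Q.polyF F1) (q' : Q.polyF
    F2) k k' : p ~p p' -> q ~p q' ->
  (forall n, k n ~f k' n) -> Q.LtSize p q k ~f Q.LtSize p' q' k'.
Proof. by move=> ep eq kk; apply: shape_Size => // n; apply: shape_Size. Qed.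

Lemma shape_LeadCoef (p : Q.polyF F1) (p' : Q.polyF F2) k k' : p ~p p' ->
  (forall t t', t ~t t' -> k t ~f k' t') -> Q.LeadCoef p k ~f Q.LeadCoef p' k'.
Proof.
elim: p p' k k' => [|t p IH] [|t' p'] k k' //=; first by move=> _; apply.
move=> [et ep] kk; apply: IH => // u u' eu.
by apply: shape_If; rewrite /= ?eu //; apply: kk.
Qed.

Lemma shape_AmulXn (t : Q.term F1) (t' : Q.term F2) n :
  t ~t t' -> Q.AmulXn t n ~p Q.AmulXn t' n.
Proof. by move=> et; elim: n => [|n IH] /=; [rewrite et|congr cons]. Qed.

Lemma shape_AddPoly (p : Q.polyF F1) (p' : Q.polyF F2) (q : Q.polyF F1) (q' : Q.polyF
    F2) : p ~p p' -> q ~p q' ->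
  Q.AddPoly p q ~p Q.AddPoly p' q'.
Proof.
elim: p p' q q' => [|t p IH] [|t' p'] [|u q] [|u' q'] //= [et ep] [eu eq].
by congr (_ :: _); [rewrite et eu|apply: IH].
Qed.

Lemma shape_ScalPoly (t : Q.term F1) (t' : Q.term F2) (p : Q.polyF F1) (p' : Q.polyF
    F2) :
  t ~t t' -> p ~p p' -> Q.ScalPoly t p ~p Q.ScalPoly t' p'.
Proof.
move=> et; elim: p p' => [|u p IH] [|u' p'] //= [eu ep].
by congr (_ :: _); [rewrite et eu|apply: IH].
Qed.

Lemma shape_MulPoly (p : Q.polyF F1) (p' : Q.polyF F2) (q : Q.polyF F1) (q' : Q.polyF
    F2) : p ~p p' -> q ~p q' ->
  Q.MulPoly p q ~p Q.MulPoly p' q'.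
Proof.
elim: p p' => [|t p IH] [|t' p'] //= [et ep] eq.
apply: shape_AddPoly; first exact: shape_ScalPoly.
by congr (_ :: _); apply: IH.
Qed.

Lemma shape_ExpPoly (p : Q.polyF F1) (p' : Q.polyF F2) n : p ~p p' -> Q.ExpPoly p n ~p
    Q.ExpPoly p' n.
Proof.
rewrite /Q.ExpPoly => ep; case: n => // n; rewrite !iteropS.
by elim: n => //= n IH; apply: shape_MulPoly.
Qed.

Lemma shape_OppPoly (p : Q.polyF F1) (p' : Q.polyF F2) : p ~p p' -> Q.OppPoly p ~p
    Q.OppPoly p'.
Proof. exact: shape_ScalPoly. Qed.

Lemma shape_NatMulPoly n (p : Q.polyF F1) (p' : Q.polyF F2) :
  p ~p p' -> Q.NatMulPoly n p ~p Q.NatMulPoly n p'.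
Proof. exact: shape_ScalPoly. Qed.

Lemma shape_Deriv (p : Q.polyF F1) (p' : Q.polyF F2) : p ~p p' -> Q.Deriv p ~p Q.Deriv
    p'.
Proof.
elim: p p' => [|t p IH] [|t' p'] //= [et ep].
by apply: shape_AddPoly => //=; congr (_ :: _); apply: IH.
Qed.

(** Pseudo-division passes on a number, which must be equal on both sides, and two polynomials,
    which need only agree in shape. *)
Definition cps_pair_shape (k : nat * Q.polyF F1 * Q.polyF F1 -> Q.formula F1)
    (k' : nat * Q.polyF F2 * Q.polyF F2 -> Q.formula F2) :=
  forall n p p' q q', p ~p p' -> q ~p q' -> k (n, p, q) ~f k' (n, p', q').

Lemma shape_Rediv_rec_loop (q : Q.polyF F1) (q' : Q.polyF F2) sq (cq : Q.term F1) (cq'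
    : Q.term F2) c (qq : Q.polyF F1) (qq' : Q.polyF F2) (r : Q.polyF F1) (r' :
    Q.polyF F2) n k k' :
  q ~p q' -> cq ~t cq' -> qq ~p qq' -> r ~p r' -> cps_pair_shape k k' ->
  Q.Rediv_rec_loop q sq cq c qq r n k ~f Q.Rediv_rec_loop q' sq cq' c qq' r' n k'.
Proof.
move=> eq ecq eqq er kk; elim: n c qq qq' r r' eqq er => [|n IH] c qq qq' r r' eqq er
  /=;
  apply: shape_Size => // sr; case: ifP => _; try exact: kk;
  apply: shape_LeadCoef => // l l' el.
- have em : Q.AmulXn l (sr - sq) ~p Q.AmulXn l' (sr - sq) by apply: shape_AmulXn.
  apply: kk; apply: shape_AddPoly => //; try apply: shape_OppPoly;
    by apply: shape_MulPoly => //=; rewrite ecq.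
- have em : Q.AmulXn l (sr - sq) ~p Q.AmulXn l' (sr - sq) by apply: shape_AmulXn.
  apply: IH; apply: shape_AddPoly => //; try apply: shape_OppPoly;
    by apply: shape_MulPoly => //=; rewrite ecq.
Qed.

Lemma shape_Rediv (p : Q.polyF F1) (p' : Q.polyF F2) (q : Q.polyF F1) (q' : Q.polyF
    F2) k k' : p ~p p' -> q ~p q' -> cps_pair_shape k k' ->
  Q.Rediv p q k ~f Q.Rediv p' q' k'.
Proof.
move=> ep eq kk; apply: shape_Isnull => // -[]; first exact: kk.
apply: shape_Size => // sq; apply: shape_Size => // sp.
by apply: shape_LeadCoef => // l l' el; apply: shape_Rediv_rec_loop.
Qed.

Lemma shape_Rmod (p : Q.polyF F1) (p' : Q.polyF F2) (q : Q.polyF F1) (q' : Q.polyF F2)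
    k k' : p ~p p' -> q ~p q' ->
  (forall r r', r ~p r' -> k r ~f k' r') -> Q.Rmod p q k ~f Q.Rmod p' q' k'.
Proof. by move=> ep eq kk; apply: shape_Rediv => // n a a' b b' ea eb; apply: kk. Qed.

Lemma shape_Rscal (p : Q.polyF F1) (p' : Q.polyF F2) (q : Q.polyF F1) (q' : Q.polyF
    F2) k k' : p ~p p' -> q ~p q' ->
  (forall n, k n ~f k' n) -> Q.Rscal p q k ~f Q.Rscal p' q' k'.
Proof. by move=> ep eq kk; apply: shape_Rediv => // n a a' b b' ea eb; apply: kk. Qed.

Lemma shape_Rgcd_loop n (p : Q.polyF F1) (p' : Q.polyF F2) (q : Q.polyF F1) (q' :
    Q.polyF F2) k k' : p ~p p' -> q ~p q' ->
  (forall r r', r ~p r' -> k r ~f k' r') ->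
  Q.Rgcd_loop n p q k ~f Q.Rgcd_loop n p' q' k'.
Proof.
move=> ep eq kk; elim: n p p' q q' ep eq => [|n IH] p p' q q' ep eq /=;
  apply: shape_Rmod => // r r' er; apply: shape_Isnull => // -[];
  by [apply: kk | apply: IH].
Qed.

Lemma shape_Rgcd (p : Q.polyF F1) (p' : Q.polyF F2) (q : Q.polyF F1) (q' : Q.polyF F2)
    k k' : p ~p p' -> q ~p q' ->
  (forall r r', r ~p r' -> k r ~f k' r') -> Q.Rgcd p q k ~f Q.Rgcd p' q' k'.
Proof.
move=> ep eq kk; apply: shape_LtSize => // -[]; apply: shape_Isnull => // -[];
  by [apply: kk | apply: shape_Size => // n; apply: shape_Rgcd_loop].
Qed.

Lemma shape_BigRgcd (s : seq (Q.polyF F1)) (s' : seq (Q.polyF F2)) k k' : s ~s s' ->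
  (forall r r', r ~p r' -> k r ~f k' r') -> Q.BigRgcd s k ~f Q.BigRgcd s' k'.
Proof.
elim: s s' k k' => [|p s IH] [|p' s'] k k' //=; first by move=> _; apply.
by case=> ep es kk; apply: IH => // r r' er; apply: shape_Rgcd.
Qed.

Lemma shape_Changes (p : Q.polyF F1) (p' : Q.polyF F2) k k' : p ~p p' -> (forall n, k
    n ~f k' n) ->
  Q.Changes p k ~f Q.Changes p' k'.
Proof.
elim: p p' k k' => [|t p IH] [|t' p'] k k' //= [et ep] kk.
apply: IH => // n; apply: shape_If => //=; rewrite et; congr (Q.Lt (Q.Mul _ _) _).
by case: p p' ep => [|u p] [|u' p'] //= [].
Qed.

Lemma shape_SeqPInfty (s : seq (Q.polyF F1)) (s' : seq (Q.polyF F2)) k k' : s ~s s' ->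
  (forall r r', r ~p r' -> k r ~f k' r') -> Q.SeqPInfty s k ~f Q.SeqPInfty s' k'.
Proof.
elim: s s' k k' => [|p s IH] [|p' s'] k k' //=; first by move=> _; apply.
case=> ep es kk; apply: shape_LeadCoef => // l l' el.
by apply: IH => // r r' er; apply: kk => /=; rewrite el er.
Qed.

Lemma shape_SeqMInfty (s : seq (Q.polyF F1)) (s' : seq (Q.polyF F2)) k k' : s ~s s' ->
  (forall r r', r ~p r' -> k r ~f k' r') -> Q.SeqMInfty s k ~f Q.SeqMInfty s' k'.
Proof.
elim: s s' k k' => [|p s IH] [|p' s'] k k' //=; first by move=> _; apply.
case=> ep es kk; apply: shape_LeadCoef => // l l' el.
apply: shape_Size => // n.
by apply: IH => // r r' er; apply: kk => /=; rewrite el er.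
Qed.

Lemma shape_ChangesPoly (s : seq (Q.polyF F1)) (s' : seq (Q.polyF F2)) k k' : s ~s s'
    -> (forall n, k n ~f k' n) ->
  Q.ChangesPoly s k ~f Q.ChangesPoly s' k'.
Proof.
move=> es kk; apply: shape_SeqMInfty => // a a' ea.
apply: shape_SeqPInfty => // b b' eb.
by apply: shape_Changes => // m; apply: shape_Changes.
Qed.

Lemma shape_NextMod (p : Q.polyF F1) (p' : Q.polyF F2) (q : Q.polyF F1) (q' : Q.polyF
    F2) k k' : p ~p p' -> q ~p q' ->
  (forall r r', r ~p r' -> k r ~f k' r') -> Q.NextMod p q k ~f Q.NextMod p' q' k'.
Proof.
move=> ep eq kk; apply: shape_LeadCoef => // l l' el.
apply: shape_Rscal => // n; apply: shape_Rmod => // r r' er.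
by apply: kk; apply: shape_ScalPoly => //=; rewrite el.
Qed.

Lemma shape_ModsAux n (p : Q.polyF F1) (p' : Q.polyF F2) (q : Q.polyF F1) (q' :
    Q.polyF F2) k k' : p ~p p' -> q ~p q' ->
  (forall s s', s ~s s' -> k s ~f k' s') ->
  Q.ModsAux p q n k ~f Q.ModsAux p' q' n k'.
Proof.
elim: n p p' q q' k k' => [|n IH] p p' q q' k k' ep eq kk /=; first exact: kk.
apply: shape_Isnull => // -[]; first exact: kk.
apply: shape_NextMod => // r r' er; apply: IH => // s s' es.
by apply: kk => /=; rewrite ep es.
Qed.

Lemma shape_Mods (p : Q.polyF F1) (p' : Q.polyF F2) (q : Q.polyF F1) (q' : Q.polyF F2)
    k k' : p ~p p' -> q ~p q' ->
  (forall s s', s ~s s' -> k s ~f k' s') -> Q.Mods p q k ~f Q.Mods p' q' k'.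
Proof.
move=> ep eq kk; apply: shape_Size => // n; apply: shape_Size => // m.
exact: shape_ModsAux.
Qed.

Lemma shape_size (s : seq (Q.polyF F1)) (s' : seq (Q.polyF F2)) :
  s ~s s' -> size s = size s'.
Proof. by move/(congr1 size); rewrite !size_map. Qed.

Lemma shape_nth (s : seq (Q.polyF F1)) (s' : seq (Q.polyF F2)) i : s ~s s' -> nth [::]
    s i ~p nth [::] s' i.
Proof. by elim: s s' i => [|p s IH] [|p' s'] // [|i] //= [ep es] //; apply: IH. Qed.

Lemma shape_PolyComb (s : seq (Q.polyF F1)) (s' : seq (Q.polyF F2)) sc : s ~s s' ->
    Q.PolyComb s sc ~p Q.PolyComb s' sc.
Proof.
move=> es; rewrite /Q.PolyComb.
have <- := shape_size es.
elim: (iota _ _) => //= i l IH; apply: shape_MulPoly => //.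
exact/shape_ExpPoly/shape_nth.
Qed.

Lemma shape_Pcq (s : seq (Q.polyF F1)) (s' : seq (Q.polyF F2)) i : s ~s s' -> Q.Pcq s
    i ~p Q.Pcq s' i.
Proof.
move=> es; apply: shape_nth.
have <- := shape_size es.
by elim: (qe_rcf_th.sg_tab _) => //= a l ->; rewrite (shape_PolyComb _ es).
Qed.

Lemma shape_TaqR (p : Q.polyF F1) (p' : Q.polyF F2) (q : Q.polyF F1) (q' : Q.polyF F2)
    k k' : p ~p p' -> q ~p q' -> (forall n, k n ~f k' n) ->
  Q.TaqR p q k ~f Q.TaqR p' q' k'.
Proof.
move=> ep eq kk; apply: shape_Mods => //.
  by apply: shape_MulPoly => //; apply: shape_Deriv.
by move=> s s' es; apply: shape_ChangesPoly.
Qed.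

Lemma shape_TaqsR (p : Q.polyF F1) (p' : Q.polyF F2) (s : seq (Q.polyF F1)) (s' : seq
    (Q.polyF F2)) i k k' : p ~p p' -> s ~s s' ->
  (forall t t', t ~t t' -> k t ~f k' t') -> Q.TaqsR p s i k ~f Q.TaqsR p' s' i k'.
Proof.
move=> ep es kk; apply: shape_TaqR => //; first exact: shape_Pcq.
by move=> n; apply: kk.
Qed.

Lemma shape_BoundingPoly (s : seq (Q.polyF F1)) (s' : seq (Q.polyF F2)) : s ~s s' ->
    Q.BoundingPoly s ~p Q.BoundingPoly s'.
Proof.
move=> es; apply: shape_Deriv.
by elim: s s' es => [|p s IH] [|p' s'] //= [ep es]; apply: shape_MulPoly => //; apply:
  IH.
Qed.

Lemma shape_CcountWeak (p : Q.polyF F1) (p' : Q.polyF F2) (s : seq (Q.polyF F1)) (s' :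
    seq (Q.polyF F2)) k k' : p ~p p' -> s ~s s' ->
  (forall t t', t ~t t' -> k t ~f k' t') ->
  Q.CcountWeak p s k ~f Q.CcountWeak p' s' k'.
Proof.
move=> ep es kk; rewrite /Q.CcountWeak.
have <- := shape_size es.
have: Q.NatConst F1 0 ~t Q.NatConst F2 0 by [].
elim: (3 ^ _)%N (Q.NatConst F1 0) (Q.NatConst F2 0) => [|n IH] t t' et.
  exact: kk.
by apply: shape_TaqsR => // u u' eu; apply: IH => /=; rewrite eu et.
Qed.

Lemma shape_CcountGt0 (s : seq (Q.polyF F1)) (s' : seq (Q.polyF F2)) (u : seq (Q.polyF
    F1)) (u' : seq (Q.polyF F2)) : s ~s s' -> u ~s u' ->
  Q.CcountGt0 s u ~f Q.CcountGt0 s' u'.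
Proof.
move=> es eu; apply: shape_BigRgcd => // r r' er; apply: shape_Isnull => // -[] /=.
  have eb := shape_BoundingPoly eu.
  apply: shape_CcountWeak => // t t' et /=; rewrite et.
  congr (Q.Or _ (Q.Or _ _)); elim: u u' eu {eb} => [|p u IH] [|p' u'] //= [ep eu];
    congr (Q.And _ _); try exact: IH.
    by apply: shape_LeadCoef => // l l' /= ->.
  by apply: shape_Size => // n; apply: shape_LeadCoef => // l l' /= ->.
by apply: shape_CcountWeak => // t t' /= ->.
Qed.

Lemma shape_abstrX i (t : Q.term F1) (t' : Q.term F2) :
  t ~t t' -> Q.abstrX i t ~p Q.abstrX i t'.
Proof.
elim: t t' => [n|c|n|t IHt u IHu|t IHt|t IHt n|t IHt u IHu|t IHt n]
    [n'|c'|n'|t' u'|t'|t' n'|t' u'|t' n'] //=; try by case=> ->.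
- by case=> ->; case: ifP.
- by case=> /IHt et /IHu eu; apply: shape_AddPoly.
- by case=> /IHt et; apply: shape_OppPoly.
- by case=> /IHt et ->; apply: shape_NatMulPoly.
- by case=> /IHt et /IHu eu; apply: shape_MulPoly.
- by case=> /IHt et ->; apply: shape_ExpPoly.
Qed.

End ProjShape.

(** * Shape invariance of disjunctive normal forms and of the whole elimination *)

Section QEShape.
Variables F1 F2 : realFieldType.

Local Notation "x ~t y" := (map (@term_shape _) x = map (@term_shape _) y)
  (at level 70).
Local Notation "x ~f y" := (formula_shape x = formula_shape y) (at level 70).

Definition pair_shape (R : Type) (b : seq (GRing.term R) * seq (GRing.term R)) :=
  (map (@term_shape R) b.1, map (@term_shape R) b.2).

Definition clause_shape (R : Type) (c : O.oclause R) : O.oclause unit :=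
  let: O.Oclause s1 s2 s3 s4 := c in
  O.Oclause (map (@term_shape R) s1) (map (@term_shape R) s2)
            (map (@term_shape R) s3) (map (@term_shape R) s4).

Lemma shape_map (A B : Type) (A' B' C C' : Type) (f : A -> B) (g : A' -> B')
    (shA : A -> C) (shA' : A' -> C) (shB : B -> C') (shB' : B' -> C') s s' :
  (forall x y, shA x = shA' y -> shB (f x) = shB' (g y)) ->
  map shA s = map shA' s' -> map shB (map f s) = map shB' (map g s').
Proof.
move=> fg; elim: s s' => [|x s IH] [|y s'] //= [exy es].
by rewrite (fg _ _ exy) (IH _ es).
Qed.

Lemma shape_and_odnf (s u : seq (O.oclause F1)) (s' u' : seq (O.oclause F2)) :
  map (@clause_shape _) s = map (@clause_shape _) s' ->
  map (@clause_shape _) u = map (@clause_shape _) u' ->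
  map (@clause_shape _) (O.and_odnf s u) = map (@clause_shape _) (O.and_odnf s' u').
Proof.
move=> es eu; rewrite /O.and_odnf.
elim: s s' es => [|c s IH] [|c' s'] //=; first by rewrite !big_nil.
case=> ec es; rewrite !big_cons !map_cat (IH s') //; congr (_ ++ _).
apply: (@shape_map _ _ _ _ _ _ _ _ (@clause_shape _) (@clause_shape _)) eu.
case: c c' ec => [a1 a2 a3 a4] [b1 b2 b3 b4] [e1 e2 e3 e4].
case=> [c1 c2 c3 c4] [d1 d2 d3 d4] /= [f1 f2 f3 f4].
by rewrite !map_cat e1 e2 e3 e4 f1 f2 f3 f4.
Qed.

Lemma shape_qf_to_odnf (f : O.formula F1) (f' : O.formula F2) b : f ~f f' ->
  map (@clause_shape _) (O.qf_to_odnf f b) = map (@clause_shape _) (O.qf_to_odnf f' b).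
Proof.
elim: f f' b => [c|t u|t u|t u|t|f IHf g IHg|f IHf g IHg|f IHf g IHg|f IHf|i f IHf|i f
  IHf]
    [c'|t' u'|t' u'|t' u'|t'|f' g'|f' g'|f' g'|f'|j f'|j f'] b //=.
- by case=> ->; case: ifP.
- by case=> et eu; case: b; rewrite /= et eu.
- by case=> et eu; case: b; rewrite /= et eu.
- by case=> et eu; case: b; rewrite /= et eu.
- by move=> _; case: b.
- case=> ef eg; case: b; last exact: shape_and_odnf (IHf _ _ ef) (IHg _ _ eg).
  by rewrite !map_cat (IHf _ _ ef) (IHg _ _ eg).
- case=> ef eg; case: b; first exact: shape_and_odnf (IHf _ _ ef) (IHg _ _ eg).
  by rewrite !map_cat (IHf _ _ ef) (IHg _ _ eg).
- case=> ef eg; case: b; first exact: shape_and_odnf (IHf _ _ ef) (IHg _ _ eg).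
  by rewrite !map_cat (IHf _ _ ef) (IHg _ _ eg).
- by case=> ef; apply: IHf.
- by case: b.
- by case: b.
Qed.

Lemma shape_leq_elim_aux (s1 s2 s3 : seq (GRing.term F1)) (r1 r2 r3 : seq (GRing.term
    F2)) :
  s1 ~t r1 -> s2 ~t r2 -> s3 ~t r3 ->
  map (@pair_shape _) (O.leq_elim_aux s1 s2 s3) =
  map (@pair_shape _) (O.leq_elim_aux r1 r2 r3).
Proof.
move=> e1 e2; elim: s3 r3 => [|t s IH] [|t' s'] //=.
  by move=> _; rewrite /pair_shape /= e1 e2.
case=> et /IH es; rewrite !map_cat; congr (_ ++ _);
  apply: (@shape_map _ _ _ _ _ _ _ _ (@pair_shape _) (@pair_shape _)) es;
  by move=> [a b] [a' b'] [ea eb]; rewrite /pair_shape /= et ea eb.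
Qed.

Lemma shape_neq_elim_aux (s1 s2 : seq (GRing.term F1)) (r1 r2 : seq (GRing.term F2)) :
  s1 ~t r1 -> s2 ~t r2 ->
  map (map (@term_shape _)) (O.neq_elim_aux s1 s2) =
  map (map (@term_shape _)) (O.neq_elim_aux r1 r2).
Proof.
move=> e1; elim: s2 r2 => [|t s IH] [|t' s'] //=; first by move=> _; rewrite e1.
case=> et /IH es; rewrite !map_cat; congr (_ ++ _);
  apply: (@shape_map _ _ _ _ _ _ _ _ (map (@term_shape _)) (map (@term_shape _))) es;
  by move=> a a' /= ->; rewrite et.
Qed.

Lemma shape_oclause_to_w (c : O.oclause F1) (c' : O.oclause F2) :
  clause_shape c = clause_shape c' ->
  map (@pair_shape _) (O.oclause_to_w c) = map (@pair_shape _) (O.oclause_to_w c').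
Proof.
move=> ec; rewrite /O.oclause_to_w /O.oclause_neq_leq_elim.
apply: (@shape_map _ _ _ _ _ _ _ _ (@clause_shape _) (@clause_shape _)).
  by case=> [a1 a2 a3 a4] [b1 b2 b3 b4] [e1 e2 e3 e4]; rewrite /pair_shape /= e1 e3.
rewrite !map_flatten; congr flatten.
apply: (@shape_map _ _ _ _ _ _ _ _ (@clause_shape _) (@clause_shape _)).
  case=> [a1 a2 a3 a4] [b1 b2 b3 b4] [e1 e2 e3 e4] /=.
  apply: (@shape_map _ _ _ _ _ _ _ _ (map (@term_shape _)) (map (@term_shape _))).
    by move=> x y exy; rewrite /= e1 e4 exy.
  exact: shape_neq_elim_aux.
case: c c' ec => [a1 a2 a3 a4] [b1 b2 b3 b4] [e1 e2 e3 e4] /=.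
apply: (@shape_map _ _ _ _ _ _ _ _ (@pair_shape _) (@pair_shape _)).
  by move=> [x y] [x' y'] [ex ey]; rewrite /= e2 ex ey.
exact: shape_leq_elim_aux.
Qed.

Lemma shape_wproj i (b : seq (GRing.term F1) * seq (GRing.term F1))
    (b' : seq (GRing.term F2) * seq (GRing.term F2)) :
  pair_shape b = pair_shape b' ->
  Q.qfr_to_formula (Q.wproj i b) ~f Q.qfr_to_formula (Q.wproj i b').
Proof.
case: b b' => [s u] [s' u'] [es eu]; rewrite !formula_shape_qf; congr Q.qfr_to_formula.
apply: shape_CcountGt0.
  apply: shape_map es => t t' /= et.
  by apply: shape_abstrX; rewrite !to_rterm_shape et.
apply: shape_map eu => t t' /= et.
by apply: shape_abstrX; rewrite !to_rterm_shape et.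
Qed.

Lemma shape_foldr_Or (s : seq (O.formula F1)) (s' : seq (O.formula F2)) :
  map (@formula_shape _) s = map (@formula_shape _) s' ->
  foldr O.Or (O.Bool false) s ~f foldr O.Or (O.Bool false) s'.
Proof. by elim: s s' => [|f s IH] [|f' s'] //= [-> /IH ->]. Qed.

Lemma shape_elim_aux i b (f : O.formula F1) (f' : O.formula F2) : f ~f f' ->
  foldr O.Or (O.Bool false)
    (map (O.proj (fun n b => Q.qfr_to_formula (Q.wproj n b)) i) (O.qf_to_odnf f b)) ~f
  foldr O.Or (O.Bool false)
    (map (O.proj (fun n b => Q.qfr_to_formula (Q.wproj n b)) i) (O.qf_to_odnf f' b)).
Proof.
move=> ef; apply: shape_foldr_Or.
apply: (@shape_map _ _ _ _ _ _ _ _ (@clause_shape _) (@clause_shape _)); last first.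
  exact: shape_qf_to_odnf.
move=> c c' ec; apply: shape_foldr_Or.
apply: (@shape_map _ _ _ _ _ _ _ _ (@pair_shape _) (@pair_shape _)); last first.
  exact: shape_oclause_to_w.
by move=> d d' /shape_wproj.
Qed.

End QEShape.

Definition qelim (R : realFieldType) : O.formula R -> O.formula R :=
  O.quantifier_elim (fun n b => Q.qfr_to_formula (Q.wproj n b)).

(** This transfers to any [R] a number computed over [rat], provided the number depends only on the
    shape of the quantifier-free formula. *)
Lemma shape_qelim (F1 F2 : realFieldType) (f : O.formula F1) (f' : O.formula F2) :
  formula_shape f = formula_shape f' ->
  formula_shape (qelim f) = formula_shape (qelim f').
Proof.
rewrite /qelim; elim: f f' => [c|t u|t u|t u|t|f IHf g IHg|f IHf g IHg|f IHf g IHg|f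
  IHf|i f IHf|i f IHf]
    [c'|t' u'|t' u'|t' u'|t'|f' g'|f' g'|f' g'|f'|j f'|j f'] //=.
- by case=> /IHf -> /IHg ->.
- by case=> /IHf -> /IHg ->.
- by case=> /IHf -> /IHg ->.
- by case=> /IHf ->.
- by case=> <- /IHf ef; apply: shape_elim_aux.
- by case=> <- /IHf ef; congr O.Not; apply: shape_elim_aux.
Qed.

Lemma qelimP (R : rcfType) (e : seq R) (f : O.formula R) : O.rformula f ->
  reflect (O.holds e f) (O.qf_eval e (qelim f)).
Proof.
exact: (O.quantifier_elim_rformP (@Q.wf_QE_wproj R) (@Q.valid_QE_wproj R)).
Qed.

Lemma qelim_wf (R : rcfType) (f : O.formula R) : O.rformula f ->
  O.qf_form (qelim f) && O.rformula (qelim f).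
Proof. exact: (O.quantifier_elim_wf (@Q.wf_QE_wproj R)). Qed.

(** * Tameness of semialgebraic sets and functions *)

Section Near.
Variable R : rcfType.
Implicit Types (P S : R -> Prop) (a b v x : R).

Definition on_itv a b P := forall x, a < x -> x < b -> P x.

(** The neighbourhood contains [v] itself, so [near P v] entails [P v]. *)
Definition near P v := exists a b, [/\ a < v, v < b & on_itv a b P].

Lemma near_and P S v : near P v -> near S v -> near (fun x => P x /\ S x) v.
Proof.
move=> [a [b [av vb Pab]]] [c [d [cv vd Scd]]].
exists (Num.max a c), (Num.min b d); split; rewrite ?gt_max ?lt_min ?av ?vb //.
by move=> x; rewrite gt_max lt_min => /andP[? ?] /andP[? ?]; split; auto.
Qed.

Lemma near_sub P S v : (forall x, P x -> S x) -> near P v -> near S v.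
Proof. by move=> PS [a [b [av vb Pab]]]; exists a, b; split=> // x ? ?; auto. Qed.

Lemma nearT v : near (fun=> True) v.
Proof. by exists (v - 1), (v + 1); rewrite ltrBlDr ltrDl ltr01. Qed.

Lemma nonroot_near (p : {poly R}) v :
  p.[v] != 0 -> near (fun x => Num.sg p.[x] = Num.sg p.[v]) v.
Proof.
(* With tolerance equal to the distance of the value from 0, nearby values keep its sign. *)
move=> pv0; have [|d d0 dP] := @polyrcf.poly_cont R v p `|p.[v]|.
  by rewrite normr_gt0.
exists (v - d), (v + d); split; rewrite ?ltrBlDr ?ltrDl // => x vx xv.
have := dP x; rewrite ltr_distl vx xv => /(_ isT).
rewrite ltr_distl; case: (ltrgt0P p.[v]) pv0 => // pv _.
- by rewrite subrr => /andP[px _]; rewrite !gtr0_sg.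
- by rewrite subrr => /andP[_ px]; rewrite !ltr0_sg.
Qed.

End Near.

Section QFormulas.
Variable R : rcfType.

(** The value 0 for inverses is a dummy: the terms of interest satisfy [GRing.rterm], which excludes
    inverses. *)
Fixpoint univ_poly (e : seq R) (i : nat) (t : GRing.term R) : {poly R} :=
  match t with
  | GRing.Var j => if j == i then 'X else (e`_j)%:P
  | GRing.Const c => c%:P
  | GRing.NatConst n => n%:R
  | GRing.Add u v => univ_poly e i u + univ_poly e i v
  | GRing.Opp u => - univ_poly e i u
  | GRing.NatMul u n => univ_poly e i u *+ n
  | GRing.Mul u v => univ_poly e i u * univ_poly e i v
  | GRing.Inv _ => 0
  | GRing.Exp u n => univ_poly e i u ^+ n
  end.

Lemma univ_polyE e i t x : GRing.rterm t ->
  (univ_poly e i t).[x] = GRing.eval (set_nth 0 e i x) t.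
Proof.
elim: t => //=.
- move=> j _; rewrite nth_set_nth /=; case: eqP => _; by rewrite ?hornerX ?hornerC.
- by move=> c _; rewrite hornerC.
- by move=> n _; rewrite -polyC_natr hornerC.
- by move=> t IHt u IHu /andP[/IHt <- /IHu <-]; rewrite hornerD.
- by move=> t IHt /IHt <-; rewrite hornerN.
- by move=> t IHt n /IHt <-; rewrite hornerMn.
- by move=> t IHt u IHu /andP[/IHt <- /IHu <-]; rewrite hornerM.
- by move=> t IHt n /IHt <-; rewrite horner_exp.
Qed.

(** A degree bound for [univ_poly e i t] read off the shape of [t], hence the same for all fields,
    constants and environments [e]. *)
Fixpoint term_deg (T : Type) (i : nat) (t : GRing.term T) : nat :=
  match t with
  | GRing.Var j => (j == i)
  | GRing.Add u v => maxn (term_deg i u) (term_deg i v)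
  | GRing.Opp u | GRing.NatMul u _ => term_deg i u
  | GRing.Mul u v => (term_deg i u + term_deg i v)%N
  | GRing.Exp u n => (term_deg i u * n)%N
  | _ => 0%N
  end.

Lemma size_univ_poly e i t : (size (univ_poly e i t) <= (term_deg i t).+1)%N.
Proof.
elim: t => //=.
- by move=> j; case: eqP => _; rewrite ?size_polyX // size_polyC leq_b1.
- by move=> c; rewrite size_polyC leq_b1.
- by move=> n; rewrite -polyC_natr size_polyC leq_b1.
- move=> t IHt u IHu; apply: leq_trans (size_polyD _ _) _.
  by rewrite geq_max (leq_trans IHt) ?(leq_trans IHu) // ltnS ?leq_maxl ?leq_maxr.
- by move=> t; rewrite size_polyN.
- move=> t IHt n; rewrite -scaler_nat.
  exact: leq_trans (size_scale_leq _ _) IHt.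
- move=> t IHt u IHu; apply: leq_trans (size_polyMleq _ _) _.
  by rewrite -ltnS; case: (size _ + size _)%N (leq_add IHt IHu) => //= n; rewrite
    addSn addnS.
- by move=> t _; rewrite size_poly0.
- move=> t IHt n; apply: leq_trans (size_poly_exp_leq _ _) _.
  by rewrite ltnS leq_mul2r -subn1 leq_subLR add1n IHt orbT.
Qed.

(** One difference per comparison suffices, because the sign of [t - u] decides equality, [<] and
    [<=] alike. *)
Fixpoint atoms (T : Type) (f : O.formula T) : seq (GRing.term T) :=
  match f with
  | O.Equal t u | O.Lt t u | O.Le t u => [:: GRing.Add t (GRing.Opp u)]
  | O.And f g | O.Or f g | O.Implies f g => atoms f ++ atoms g
  | O.Not f => atoms f
  | _ => [::]
  end.

Lemma term_deg_shape (T : Type) i (t : GRing.term T) :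
  term_deg i (term_shape t) = term_deg i t.
Proof. by elim: t => //= [t -> u ->|t -> u ->|t -> n]. Qed.

Lemma atoms_shape (T : Type) (f : O.formula T) :
  atoms (formula_shape f) = map (@term_shape T) (atoms f).
Proof. by elim: f => //= f -> g ->; rewrite map_cat. Qed.

(** Each atom vanishes identically or is nonzero at [v], so its sign is constant near [v], and these
    signs determine the truth value. *)
Lemma qf_near_const e i (f : O.formula R) v : O.qf_form f && O.rformula f ->
  all (fun t => (univ_poly e i t == 0) || ((univ_poly e i t).[v] != 0)) (atoms f) ->
  near (fun x => O.qf_eval (set_nth 0 e i x) f = O.qf_eval (set_nth 0 e i v) f) v.
Proof.
have near_atom t u : GRing.rterm t && GRing.rterm u ->
  (univ_poly e i t - univ_poly e i u == 0) ||
    ((univ_poly e i t - univ_poly e i u).[v] != 0) ->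
  near (fun x => Num.sg (GRing.eval (set_nth 0 e i x) t - GRing.eval (set_nth 0 e i x)
    u)
    = Num.sg (GRing.eval (set_nth 0 e i v) t - GRing.eval (set_nth 0 e i v) u)) v.
  case/andP=> rt ru /orP[/eqP p0|/nonroot_near].
    apply: near_sub (nearT v) => x _.
    by rewrite -!univ_polyE // -!hornerN -!hornerD p0 !horner0.
  by apply: near_sub => x; rewrite !hornerD !hornerN !univ_polyE.
elim: f => //=; try by move=> *; apply: near_sub (nearT v).
- move=> t u rtu; rewrite andbT => /(near_atom _ _ rtu); apply: near_sub => x.
  by rewrite -![_ == GRing.eval _ u]subr_eq0 -!(sgr_eq0 (_ - _)) => ->.
- move=> t u rtu; rewrite andbT => /(near_atom _ _ rtu); apply: near_sub => x.
  by rewrite -![_ < GRing.eval _ u]subr_lt0 -!(sgr_lt0 (_ - _)) => ->.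
- move=> t u rtu; rewrite andbT => /(near_atom _ _ rtu); apply: near_sub => x.
  by rewrite -![_ <= GRing.eval _ u]subr_le0 -!(sgr_le0 (_ - _)) => ->.
- move=> f IHf g IHg; rewrite andbACA all_cat => /andP[wf wg] /andP[Af Ag].
  by apply: near_sub (near_and (IHf wf Af) (IHg wg Ag)) => x [-> ->].
- move=> f IHf g IHg; rewrite andbACA all_cat => /andP[wf wg] /andP[Af Ag].
  by apply: near_sub (near_and (IHf wf Af) (IHg wg Ag)) => x [-> ->].
- move=> f IHf g IHg; rewrite andbACA all_cat => /andP[wf wg] /andP[Af Ag].
  by apply: near_sub (near_and (IHf wf Af) (IHg wg Ag)) => x [-> ->].
- by move=> f IHf wf Af; apply: near_sub (IHf wf Af) => x ->.
Qed.

(** Identically vanishing atoms contribute nothing, since [rootsR] of 0 is empty; outside the list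
    every atom is identically zero or nonzero. *)
Definition atom_roots e i (f : O.formula R) : seq R :=
  flatten (map (fun t => polyrcf.rootsR (univ_poly e i t)) (atoms f)).

Lemma size_rootsR (p : {poly R}) : (size (polyrcf.rootsR p) <= (size p).-1)%N.
Proof.
have [->|p0] := eqVneq p 0; first by rewrite polyrcf.rootsR0.
rewrite -ltnS prednK ?size_poly_gt0 //; apply: max_poly_roots => //.
  by apply/allP => x; rewrite -(polyrcf.roots_on_rootsR p0) => /andP[].
exact: polyrcf.uniq_roots.
Qed.

Lemma size_atom_roots e i f :
  (size (atom_roots e i f) <= sumn (map (term_deg i) (atoms f)))%N.
Proof.
rewrite /atom_roots; elim: (atoms f) => //= t s IH; rewrite size_cat leq_add //.
apply: leq_trans (size_rootsR _) _.
by rewrite -subn1 leq_subLR add1n size_univ_poly.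
Qed.

Lemma atom_rootsP e i f v : v \notin atom_roots e i f ->
  all (fun t => (univ_poly e i t == 0) || ((univ_poly e i t).[v] != 0)) (atoms f).
Proof.
rewrite /atom_roots; elim: (atoms f) => //= t s IH.
rewrite mem_cat negb_or => /andP[vt /IH ->]; rewrite andbT.
have [//|p0] := eqVneq (univ_poly e i t) 0.
by move: vt; rewrite -(polyrcf.roots_on_rootsR p0) inE /= /root.
Qed.

End QFormulas.

(** * Total environments, renaming and de Bruijn binders *)

Definition scons (T : Type) (x : T) (e : nat -> T) (i : nat) : T :=
  if i is j.+1 then e j else x.
Notation "x .: e" := (scons x e) (at level 55, right associativity).

Section EnvSemantics.
Variable R : rcfType.
Implicit Types (e : nat -> R).

(** Total environments in place of lists make prepending a value and renaming variables free of
    conditions on lengths. *)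
Fixpoint env_eval e (t : oterm) : R :=
  match t with
  | TVar i => e i
  | TZero => 0
  | TOne => 1
  | TAdd u v => env_eval e u + env_eval e v
  | TOpp u => - env_eval e u
  | TMul u v => env_eval e u * env_eval e v
  end.

Definition env_set e (i : nat) (x : R) (j : nat) : R := if j == i then x else e j.

Fixpoint env_holds e (f : oformula) : Prop :=
  match f with
  | FTrue => True
  | FFalse => False
  | FEq t u => env_eval e t = env_eval e u
  | FLt t u => env_eval e t < env_eval e u
  | FNot g => ~ env_holds e g
  | FAnd g h => env_holds e g /\ env_holds e h
  | FOr g h => env_holds e g \/ env_holds e h
  | FImp g h => env_holds e g -> env_holds e h
  | FEx i g => exists x, env_holds (env_set e i x) g
  | FAll i g => forall x, env_holds (env_set e i x) g
  end.

End EnvSemantics.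

Fixpoint term_bound (t : oterm) : nat :=
  match t with
  | TVar i => i.+1
  | TZero | TOne => 0
  | TAdd u v | TMul u v => maxn (term_bound u) (term_bound v)
  | TOpp u => term_bound u
  end.

(** Only indices occurring in terms count: a quantifier over a variable that does not occur has no
    influence on truth. *)
Fixpoint var_bound (f : oformula) : nat :=
  match f with
  | FTrue | FFalse => 0
  | FEq t u | FLt t u => maxn (term_bound t) (term_bound u)
  | FNot g => var_bound g
  | FAnd g h | FOr g h | FImp g h => maxn (var_bound g) (var_bound h)
  | FEx i g | FAll i g => var_bound g
  end.

Fixpoint rename_term (r : nat -> nat) (t : oterm) : oterm :=
  match t with
  | TVar i => TVar (r i)
  | TZero => TZero
  | TOne => TOne
  | TAdd u v => TAdd (rename_term r u) (rename_term r v)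
  | TOpp u => TOpp (rename_term r u)
  | TMul u v => TMul (rename_term r u) (rename_term r v)
  end.

Fixpoint rename (r : nat -> nat) (f : oformula) : oformula :=
  match f with
  | FTrue => FTrue
  | FFalse => FFalse
  | FEq t u => FEq (rename_term r t) (rename_term r u)
  | FLt t u => FLt (rename_term r t) (rename_term r u)
  | FNot g => FNot (rename r g)
  | FAnd g h => FAnd (rename r g) (rename r h)
  | FOr g h => FOr (rename r g) (rename r h)
  | FImp g h => FImp (rename r g) (rename r h)
  | FEx i g => FEx (r i) (rename r g)
  | FAll i g => FAll (r i) (rename r g)
  end.

Section EnvLemmas.
Variable R : rcfType.
Implicit Types (e : nat -> R) (f : oformula).

Lemma env_eval_seq e (s : seq R) t :
  (forall i, (i < term_bound t)%N -> s`_i = e i) ->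
  eval_term s t = env_eval e t.
Proof.
elim: t => //= [i|t IHt u IHu|t IHt|t IHt u IHu] es; first exact: es.
- by rewrite ?IHt ?IHu // => i li; apply: es; rewrite leq_max li ?orbT.
- by rewrite IHt.
- by rewrite ?IHt ?IHu // => i li; apply: es; rewrite leq_max li ?orbT.
Qed.

Lemma env_holds_seq e (s : seq R) f :
  (forall i, (i < var_bound f)%N -> s`_i = e i) -> holds s f <-> env_holds e f.
Proof.
elim: f e s => //=
  [t u|t u|f IHf|f IHf g IHg|f IHf g IHg|f IHf g IHg|i f IHf|i f IHf] e s es.
- by rewrite !(@env_eval_seq e s) // => i li; apply: es; rewrite leq_max li ?orbT.
- by rewrite !(@env_eval_seq e s) // => i li; apply: es; rewrite leq_max li ?orbT.
- by rewrite (IHf _ _ es).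
- by rewrite (IHf e) ?(IHg e) // => i li; apply: es; rewrite leq_max li ?orbT.
- by rewrite (IHf e) ?(IHg e) // => i li; apply: es; rewrite leq_max li ?orbT.
- by rewrite (IHf e) ?(IHg e) // => i li; apply: es; rewrite leq_max li ?orbT.
- by split=> -[x fx]; exists x; move: fx; apply IHf => j lj;
    rewrite nth_set_nth /env_set /= es.
- by split=> fx x; move: (fx x); apply IHf => j lj;
    rewrite nth_set_nth /env_set /= es.
Qed.

Lemma env_holds_ext e e' f :
  (forall i, (i < var_bound f)%N -> e i = e' i) -> env_holds e f <-> env_holds e' f.
Proof.
move=> ee; rewrite -(@env_holds_seq e (mkseq e (var_bound f))); last first.
  by move=> i li; rewrite nth_mkseq.
by apply: env_holds_seq => i li; rewrite nth_mkseq // ee.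
Qed.

Lemma env_eval_rename r e e' t : (forall i, e' i = e (r i)) ->
  env_eval e (rename_term r t) = env_eval e' t.
Proof.
by move=> ee; elim: t => //= [t -> u ->|t ->|t -> u ->].
Qed.

(** [rename] acts on bound indices too; injectivity of [r] prevents a renamed quantifier from
    capturing another variable. *)
Lemma env_holds_rename r e e' f : injective r -> (forall i, e' i = e (r i)) ->
  env_holds e (rename r f) <-> env_holds e' f.
Proof.
move=> ri; elim: f e e' => //=
  [t u|t u|f IHf|f IHf g IHg|f IHf g IHg|f IHf g IHg|i f IHf|i f IHf] e e' ee.
- by rewrite !(env_eval_rename _ ee).
- by rewrite !(env_eval_rename _ ee).
- by rewrite (IHf _ _ ee).
- by rewrite (IHf _ _ ee) (IHg _ _ ee).
- by rewrite (IHf _ _ ee) (IHg _ _ ee).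
- by rewrite (IHf _ _ ee) (IHg _ _ ee).
- by split=> -[x fx]; exists x; move: fx; apply IHf => j;
    rewrite /env_set (inj_eq ri) ee.
- by split=> fx x; move: (fx x); apply IHf => j;
    rewrite /env_set (inj_eq ri) ee.
Qed.

End EnvLemmas.

(* The permutation (0 m m-1 ... 1): it moves the de Bruijn variable 0 to the
   name m, which clashes with nothing when m bounds the variables in use. *)
Definition cycle_down (m i : nat) : nat :=
  if i is j.+1 then if (j < m)%N then j else i else m.

Lemma cycle_down_inj m : injective (cycle_down m).
Proof.
move=> [|i] [|j] //=.
- by case: (ltnP j m) => lj ej; exfalso; lia.
- by case: (ltnP i m) => li ei; exfalso; lia.
- by case: (ltnP i m) (ltnP j m) => li [] lj ej; lia.
Qed.

(** De Bruijn quantifier on top of the named one: index 0 of [f] is bound, and index [i.+1] of [f]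
    refers to index [i] outside. *)
Definition DEx (f : oformula) : oformula :=
  FEx (var_bound f) (rename (cycle_down (var_bound f)) f).

Definition DAll (f : oformula) : oformula := FNot (DEx (FNot f)).

Section Binders.
Variable R : rcfType.
Implicit Types (e : nat -> R) (f : oformula).

Lemma env_holds_DEx e f :
  env_holds e (DEx f) <-> exists x, env_holds (x .: e) f.
Proof.
suff fE x : env_holds (env_set e (var_bound f) x)
      (rename (cycle_down (var_bound f)) f) <-> env_holds (x .: e) f.
  by split=> -[x /fE fx]; exists x.
rewrite (env_holds_rename _ (@cycle_down_inj _) (fun=> erefl)).
apply: env_holds_ext => -[|i] li /=; rewrite /env_set ?eqxx //.
by rewrite (ltnW li) (ltn_eqF (ltnW li)).
Qed.

Lemma env_holds_DAll e f :
  env_holds e (DAll f) <-> forall x, env_holds (x .: e) f.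
Proof.
rewrite -[X in X <-> _]/(~ env_holds e (DEx (FNot f))) env_holds_DEx; split=> [nf x|fx
  [x]]; last by apply; apply: fx.
by apply: NNPP => nfx; apply: nf; exists x.
Qed.

End Binders.

(** * Translation to the input of quantifier elimination, and uniform finiteness *)

Fixpoint rcf_term (T : Type) (t : oterm) : GRing.term T :=
  match t with
  | TVar i => GRing.Var T i
  | TZero => GRing.NatConst T 0
  | TOne => GRing.NatConst T 1
  | TAdd u v => GRing.Add (rcf_term T u) (rcf_term T v)
  | TOpp u => GRing.Opp (rcf_term T u)
  | TMul u v => GRing.Mul (rcf_term T u) (rcf_term T v)
  end.

Fixpoint rcf_formula (T : Type) (f : oformula) : O.formula T :=
  match f with
  | FTrue => O.Bool true
  | FFalse => O.Bool false
  | FEq t u => O.Equal (rcf_term T t) (rcf_term T u)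
  | FLt t u => O.Lt (rcf_term T t) (rcf_term T u)
  | FNot g => O.Not (rcf_formula T g)
  | FAnd g h => O.And (rcf_formula T g) (rcf_formula T h)
  | FOr g h => O.Or (rcf_formula T g) (rcf_formula T h)
  | FImp g h => O.Implies (rcf_formula T g) (rcf_formula T h)
  | FEx i g => O.Exists i (rcf_formula T g)
  | FAll i g => O.Forall i (rcf_formula T g)
  end.

(* Any other real field would do in place of [rat]: see [shape_qelim]. *)
Definition isolated_bound (f : oformula) : nat :=
  sumn (map (term_deg 0) (atoms (qelim (rcf_formula rat f)))).

Section Tameness.
Variable R : rcfType.
Implicit Types (e : nat -> R) (f : oformula).

Lemma term_shape_rcf T t : term_shape (rcf_term T t) = rcf_term unit t.
Proof. by elim: t => //= [t -> u ->|t ->|t -> u ->]. Qed.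

Lemma formula_shape_rcf T f : formula_shape (rcf_formula T f) = rcf_formula unit f.
Proof.
by elim: f => //= [t u|t u|f ->|f -> g ->|f -> g ->|f -> g ->|i f ->|i f ->];
  rewrite ?term_shape_rcf.
Qed.

Lemma rterm_rcf t : GRing.rterm (rcf_term R t).
Proof. by elim: t => //= t -> u ->. Qed.

Lemma rformula_rcf f : O.rformula (rcf_formula R f).
Proof. by elim: f => //= [t u|t u|f -> g ->|f -> g ->|f -> g ->]; rewrite ?rterm_rcf.
  Qed.

Lemma eval_rcf (s : seq R) t : GRing.eval s (rcf_term R t) = eval_term s t.
Proof. by elim: t => //= [t -> u ->|t ->|t -> u ->]. Qed.

Lemma holds_rcf (s : seq R) f : O.holds s (rcf_formula R f) <-> holds s f.
Proof.
elim: f s => //= [t u|t u|f IHf|f IHf g IHg|f IHf g IHg|f IHf g IHg|i f IHf|i f IHf] s.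
- by rewrite !eval_rcf.
- by rewrite !eval_rcf.
- by rewrite IHf.
- by rewrite IHf IHg.
- by rewrite IHf IHg.
- by rewrite IHf IHg.
- by split=> -[x /IHf fx]; exists x.
- by split=> fx x; apply/IHf.
Qed.

(** The exceptions are the roots of the atoms of an equivalent quantifier-free formula. Here [f] may
    contain constants from [R]. *)
Lemma holds_near_const (s : seq R) i (f : O.formula R) : O.rformula f ->
  exists2 l : seq R, (size l <= sumn (map (term_deg i) (atoms (qelim f))))%N &
    forall v, v \notin l ->
      near (fun u => O.holds (set_nth 0 s i u) f <-> O.holds (set_nth 0 s i v) f) v.
Proof.
move=> rf; exists (atom_roots s i (qelim f)); first exact: size_atom_roots.
move=> v /atom_rootsP /(qf_near_const (qelim_wf rf)); apply: near_sub => u fuv.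
split=> /(qelimP _ rf) fu; apply/(qelimP _ rf); by rewrite ?fuv // -fuv.
Qed.

(** The bound depends on neither [R] nor [e]. A set without interior that is defined by [f] is
    contained in [l], so its size is bounded uniformly. *)
Lemma env_holds_near_const e f :
  exists2 l : seq R, (size l <= isolated_bound f)%N &
    forall v, v \notin l ->
      near (fun u => env_holds (u .: e) f <-> env_holds (v .: e) f) v.
Proof.
pose s := mkseq (0 .: e) (var_bound f).+1.
have fE v : O.holds (set_nth 0 s 0 v) (rcf_formula R f) <-> env_holds (v .: e) f.
  rewrite holds_rcf; apply: env_holds_seq => -[|i] // li.
  by rewrite nth_set_nth; apply: (nth_mkseq 0 (0 .: e)); rewrite ltnS ltnW.
have [l sl lP] := holds_near_const s 0 (rformula_rcf f).
exists l => [|v /lP].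
  (* The atoms over [rat] and over [R] have equal shapes, hence equal degree bounds. *)
  have sh : formula_shape (qelim (rcf_formula rat f)) =
            formula_shape (qelim (rcf_formula R f)).
    by apply: shape_qelim; rewrite !formula_shape_rcf.
  move: (congr1 (fun g => sumn (map (term_deg 0) (atoms g))) sh).
  rewrite !atoms_shape -!map_comp !(eq_map (fun t => term_deg_shape 0%N t)) => shE.
  by rewrite /isolated_bound shE.
by apply: near_sub => u; rewrite !fE.
Qed.

(** * Polynomial relations along the graph of a semialgebraic function *)

Section DefinableFunction.
Variables (s : seq R) (H : oformula) (h : R -> R).
Hypothesis HE : forall x z,
  O.holds (set_nth 0 (set_nth 0 s 1 x) 0 z) (rcf_formula R H) <-> z = h x.

(** The outer indeterminate is the value [z] (variable 0), the inner one the argument [x] (variable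
    1), so [Q.[z%:P].[x]] is Q(x, z). *)
Fixpoint bivariate_poly (t : GRing.term R) : {poly {poly R}} :=
  match t with
  | GRing.Var j => if j == 0%N then 'X else if j == 1%N then 'X%:P else (s`_j)%:P%:P
  | GRing.Const c => c%:P%:P
  | GRing.NatConst n => n%:R
  | GRing.Add u v => bivariate_poly u + bivariate_poly v
  | GRing.Opp u => - bivariate_poly u
  | GRing.NatMul u n => bivariate_poly u *+ n
  | GRing.Mul u v => bivariate_poly u * bivariate_poly v
  | GRing.Inv _ => 0
  | GRing.Exp u n => bivariate_poly u ^+ n
  end.

Lemma map_bivariate_poly x t :
  map_poly (horner_eval x) (bivariate_poly t) = univ_poly (set_nth 0 s 1 x) 0 t.
Proof.
elim: t => //= [j|c|n|t IHt u IHu|t IHt|t IHt n|t IHt u IHu|t _|t IHt n].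
- case: eqP => [_|_]; first exact: map_polyX.
  rewrite nth_set_nth /=; case: eqP => _; rewrite map_polyC /= /horner_eval ?hornerX //.
  by rewrite hornerC.
- by rewrite map_polyC /= /horner_eval hornerC.
- by rewrite rmorph_nat.
- by rewrite rmorphD /= IHt IHu.
- by rewrite rmorphN /= IHt.
- by rewrite rmorphMn /= IHt.
- by rewrite rmorphM /= IHt IHu.
- exact: rmorph0.
- by rewrite rmorphXn /= IHt.
Qed.

(** [Q] is the product of the nonzero atoms. If it did not vanish at (x, h x), the truth of z = h x
    would be constant for z near h x, although a single z satisfies it. *)
Lemma holds_fun_algebraic :
  exists2 Q : {poly {poly R}}, Q != 0 & forall x, Q.[(h x)%:P].[x] = 0.
Proof.
pose ts := atoms (qelim (rcf_formula R H)).
exists (\prod_(t <- ts | bivariate_poly t != 0) bivariate_poly t).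
  by rewrite prodf_seq_neq0; elim: ts => //= t ts ->; rewrite implybb.
move=> x; apply/eqP; apply: contraT => Qx.
have /(qf_near_const (qelim_wf (rformula_rcf H))) :
    all (fun t => (univ_poly (set_nth 0 s 1 x) 0 t == 0) ||
      ((univ_poly (set_nth 0 s 1 x) 0 t).[h x] != 0)) ts.
  elim: ts Qx => //= t ts IH; rewrite big_cons; have [t0|t0] := eqVneq (bivariate_poly
    t) 0.
    by move/IH ->; rewrite -map_bivariate_poly t0 rmorph0 eqxx.
  rewrite !hornerM mulf_eq0 negb_or => /andP[tx /IH ->].
  rewrite -map_bivariate_poly andbT; apply/orP; right.
  have := horner_map (horner_eval x) (bivariate_poly t) (h x)%:P.
  by rewrite /= /horner_eval hornerC => ->.
move=> [a [b [ah hb near_h]]].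
have hx : O.qf_eval (set_nth 0 (set_nth 0 s 1 x) 0 (h x)) (qelim (rcf_formula R H)).
  by apply/(qelimP _ (rformula_rcf H))/HE.
(* The midpoint of h x and [b] would be a second value of the function at [x]. *)
have := midf_lt hb; set u := _ / _ => -[hu ub].
have := near_h u (lt_trans ah hu) ub; rewrite hx.
by move/(qelimP _ (rformula_rcf H))/HE => uh; rewrite uh ltxx in hu.
Qed.

Definition univ_term (i : nat) (p : seq R) : GRing.term R :=
  foldr (fun c t => GRing.Add (GRing.Mul t (GRing.Var R i)) (GRing.Const c))
    (GRing.NatConst R 0) p.

Definition bivariate_term (q : seq {poly R}) : GRing.term R :=
  foldr (fun (c : {poly R}) t => GRing.Add (GRing.Mul t (GRing.Var R 0)) (univ_term 1
    c))
    (GRing.NatConst R 0) q.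

(** The condition q(v, h v) = 0 is expressed by a formula with the coefficients of [q] as constants,
    to which [holds_near_const] applies. *)
Lemma holds_fun_tame (q : {poly {poly R}}) :
  exists l : seq R, forall v, v \notin l -> q.[(h v)%:P].[v] = 0 ->
    near (fun u => q.[(h u)%:P].[u] = 0) v.
Proof.
pose f := O.Exists 0
  (O.And (rcf_formula R H) (O.Equal (bivariate_term q) (GRing.NatConst R 0))).
have rf : O.rformula f.
  rewrite /= rformula_rcf /= andbT /bivariate_term.
  elim: (polyseq q) => //= c r ->; rewrite andbT /= /univ_term.
  by elim: (polyseq c) => //= a p ->.
have fE v : O.holds (set_nth 0 s 1 v) f <-> q.[(h v)%:P].[v] = 0.
  have tE z : GRing.eval (set_nth 0 (set_nth 0 s 1 v) 0 z) (bivariate_term q)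
              = q.[z%:P].[v].
    have s0 : (set_nth 0 (set_nth 0 s 1 v) 0 z)`_0 = z by rewrite nth_set_nth.
    have s1 : (set_nth 0 (set_nth 0 s 1 v) 0 z)`_1 = v.
      by rewrite nth_set_nth -[LHS]/((set_nth 0 s 1 v)`_1) nth_set_nth.
    rewrite -[q.[_]]/(horner_rec q z%:P).
    elim: (polyseq q) => /= [|c r ->]; first by rewrite horner0.
    rewrite hornerD hornerM hornerC s0; congr (_ * _ + _).
    by rewrite /horner; elim: (polyseq c) => //= a p ->; rewrite s1.
  split=> /=; first by move=> [z [/HE ->]]; rewrite tE.
  by move=> q0; exists (h v); rewrite tE q0; split=> //; apply/HE.
have [l _ lP] := holds_near_const s 1 rf.
exists l => v /lP nv qv; apply: near_sub nv => u.
by rewrite !fE => uv; apply/uv.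
Qed.

End DefinableFunction.

Variables (e : nat -> R) (H : oformula) (h : R -> R).
Hypothesis HP : forall x z, env_holds (z .: x .: e) H <-> z = h x.

(** The two leading zeros are placeholders, overwritten by the value and the argument. *)
Let s := mkseq (0 .: 0 .: e) (var_bound H).+2.

Let HE x z : O.holds (set_nth 0 (set_nth 0 s 1 x) 0 z) (rcf_formula R H) <-> z = h x.
Proof.
rewrite holds_rcf -HP; apply: env_holds_seq => -[|[|i]] // li.
transitivity s`_i.+2.
  by rewrite nth_set_nth -[LHS]/((set_nth 0 s 1 x)`_i.+2) nth_set_nth.
apply: (nth_mkseq 0 (0 .: 0 .: e)); lia.
Qed.

Lemma definable_fun_algebraic :
  exists2 Q : {poly {poly R}}, Q != 0 & forall x, Q.[(h x)%:P].[x] = 0.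
Proof. exact: holds_fun_algebraic HE. Qed.

Lemma definable_fun_tame (q : {poly {poly R}}) :
  exists l : seq R, forall v, v \notin l -> q.[(h v)%:P].[v] = 0 ->
    near (fun u => q.[(h u)%:P].[u] = 0) v.
Proof. exact: holds_fun_tame HE q. Qed.

End Tameness.

(** * Avoiding a proper subfield on an interval *)

Lemma injective_notin (T : eqType) (u : nat -> T) (l : seq T) :
  injective u -> exists n, u n \notin l.
Proof.
move=> ui; apply: NNPP => nex.
have /(uniq_leq_size _) : {subset map u (iota 0 (size l).+1) <= l}.
  move=> _ /mapP[n _ ->]; apply: contraT => nl; case: nex; by exists n.
by rewrite map_inj_uniq // iota_uniq size_map size_iota ltnn => /(_ isT).
Qed.

Section Subfield.
Variables (R : rcfType) (F : R -> Prop).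
Hypothesis FF : is_subfield F.

Lemma sf0 : F 0. Proof. by case: FF. Qed.
Lemma sf1 : F 1. Proof. by case: FF => _ []. Qed.
Lemma sfD x y : F x -> F y -> F (x + y).
Proof. by case: FF => _ [_ [FD _]]; apply: FD. Qed.
Lemma sfN x : F x -> F (- x).
Proof. by case: FF => _ [_ [_ [FN _]]]; apply: FN. Qed.
Lemma sfB x y : F x -> F y -> F (x - y).
Proof. by move=> Fx Fy; apply: sfD => //; apply: sfN. Qed.
Lemma sfM x y : F x -> F y -> F (x * y).
Proof. by case: FF => _ [_ [_ [_ [FM _]]]]; apply: FM. Qed.
Lemma sfV x : F x -> F x^-1.
Proof.
have [->|x0] := eqVneq x 0; first by rewrite invr0.
by case: FF => _ [_ [_ [_ [_ FV]]]] Fx; apply: FV.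
Qed.
Lemma sfX x n : F x -> F (x ^+ n).
Proof. by move=> Fx; elim: n => [|n IH]; [exact: sf1|rewrite exprS; apply: sfM]. Qed.
Lemma sf_nat n : F n%:R.
Proof. by elim: n => [|n IH]; [exact: sf0|rewrite -natr1; apply: sfD sf1]. Qed.
Lemma sf_div x y : F x -> F y -> F (x / y).
Proof. by move=> Fx Fy; apply: sfM => //; apply: sfV. Qed.
(* [d] is an F-linear functional on the F-span of the family [c], presented
   by its values; it separates [c i1] from F. *)
Lemma separating_functional (I : finType) (c : I -> R) (i0 i1 : I) :
  c i0 = 1 -> ~ F (c i1) ->
  exists d : I -> R, [/\ d i0 = 0, d i1 = 1 &
    forall f : I -> R, (forall i, F (f i)) -> \sum_i f i * c i = 0 ->
      \sum_i f i * d i = 0].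
Proof.
move=> c0 c1.
have i10 : i1 != i0 by apply/eqP => e; apply: c1; rewrite e c0; exact: sf1.
(* Induction on a list containing the support of [f]; [enum I] allows every index. *)
suff /(_ (enum I)) [d [d0 d1 dP]] : forall s : seq I,
    exists d : I -> R, [/\ d i0 = 0, d i1 = 1 &
    forall f : I -> R, (forall i, F (f i)) ->
      (forall i, i \notin [:: i0, i1 & s] -> f i = 0) ->
      \sum_i f i * c i = 0 -> \sum_i f i * d i = 0].
  exists d; split=> // f Ff; apply: dP => // i.
  by rewrite !inE mem_enum inE !orbT.
elim=> [|k s [d [d0 d1 dP]]].
  (* A relation between 1 and [c i1] with coefficients in F forces [f i1 = 0], because [c i1] is not
     in F. *)
  exists (fun i => (i == i1)%:R); rewrite eqxx eq_sym (negPf i10); split=> // f Ff f0.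
  have sumE (g : I -> R) : \sum_i f i * g i = f i0 * g i0 + f i1 * g i1.
    rewrite (bigD1 i0) //= (bigD1 i1) //= big1 ?addr0 // => i /andP[ii0 ii1].
    by rewrite f0 ?mul0r // !inE negb_or ii0 ii1.
  rewrite !sumE c0 mulr1 eqxx eq_sym (negPf i10) mulr0 add0r mulr1 => e.
  have [//|f1] := eqVneq (f i1) 0; case: c1.
  have -> : c i1 = - f i0 / f i1 by apply: (mulfI f1); rewrite mulrCA divff // mulr1;
    lra.
  by apply: sf_div => //; apply: sfN.
have [ks|ks] := boolP (k \in [:: i0, i1 & s]).
  exists d; split=> // f Ff f0; apply: dP => // i ni; apply: f0.
  by apply: contra ni; rewrite !inE => /or4P[->|->|/eqP ->|->]; rewrite ?orbT //;
     rewrite !inE in ks.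
have kE (d' : I -> R) (y : R) f : \sum_i f i * (if i == k then y else d' i) =
    \sum_i (if i == k then 0 else f i) * d' i + f k * y.
  rewrite (bigD1 k) //= eqxx addrC [in RHS](bigD1 k) //= eqxx mul0r add0r.
  by congr (_ + _); apply: eq_bigr => i /negPf ->.
have cE f : \sum_i f i * c i = \sum_i (if i == k then 0 else f i) * c i + f k * c k.
  by rewrite -kE; apply: eq_bigr => i _; case: eqP => // ->.
have F0 f : (forall i, F (f i)) -> forall i, F (if i == k then 0 else f i).
  by move=> Ff i; case: ifP => // _; exact: sf0.
have supp (f : I -> R) : (forall i, i \notin [:: i0, i1, k & s] -> f i = 0) ->
    forall i, i \notin [:: i0, i1 & s] -> (if i == k then 0 else f i) = 0.
  move=> f0 i ni; case: eqP => // /eqP ik; apply: f0; move: ni.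
  by rewrite !inE (negPf ik).
have k01 y : (if i0 == k then y else d i0) = 0 /\ (if i1 == k then y else d i1) = 1.
  by move: ks; rewrite !inE !negb_or ![k == _]eq_sym => /and3P[/negPf -> /negPf -> _].
(* If [c k] is an F-combination of the earlier values, linearity dictates [d k]; otherwise no
   relation involves [k], and [d k] can be set to 0. *)
have [[g [Fg g0 gk]]|ncomb] := classic (exists g : I -> R, [/\ forall i, F (g i),
    forall i, i \notin [:: i0, i1 & s] -> g i = 0 & \sum_i g i * c i = c k]).
  exists (fun i => if i == k then \sum_i g i * d i else d i).
  split; try by case: (k01 (\sum_i g i * d i)).
  move=> f Ff f0; rewrite kE cE -gk !mulr_sumr -!big_split /= => e.
  rewrite -[RHS](dP (fun i => (if i == k then 0 else f i) + f k * g i)).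
  - by apply: eq_bigr => i _; rewrite mulrDl mulrA.
  - by move=> i; apply: sfD; [apply: F0|apply: sfM].
  - by move=> i ni; rewrite g0 // mulr0 addr0; apply: supp.
  - by rewrite -[RHS]e; apply: eq_bigr => i _; rewrite mulrDl mulrA.
exists (fun i => if i == k then 0 else d i).
split; try by case: (k01 0).
move=> f Ff f0; rewrite kE cE mulr0 addr0 => e.
have [fk|fk] := eqVneq (f k) 0.
  by apply: dP; [exact: F0|exact: supp|rewrite fk mul0r addr0 in e].
case: ncomb; exists (fun i => - (if i == k then 0 else f i) / f k); split.
- by move=> i; apply: sf_div => //; apply: sfN; apply: F0.
- by move=> i ni; rewrite supp // oppr0 mul0r.
- rewrite (eq_bigr (fun i => - (f k)^-1 * ((if i == k then 0 else f i) * c i))).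
    by rewrite -mulr_sumr (eqP (eq_trans (esym (addr_eq0 _ _)) (introT eqP e))) mulrNN
      mulKf.
  by move=> i _; rewrite !mulNr mulrA [_ / _]mulrC.
Qed.

End Subfield.

(** * Minimal polynomials of tame functions *)

Section TameFunctions.
Variable R : rcfType.
Implicit Types (a b c d v x : R) (h : R -> R) (q Q : {poly {poly R}}).

(** The two consequences of definability used from here on: the graph lies on an algebraic curve,
    and apart from finitely many points a polynomial relation on the graph spreads to a
    neighbourhood. *)
Definition tame_fun h :=
  (exists2 Q : {poly {poly R}}, Q != 0 & forall x, Q.[(h x)%:P].[x] = 0) /\
  (forall q, exists l : seq R, forall v, v \notin l -> q.[(h v)%:P].[v] = 0 ->
    near (fun u => q.[(h u)%:P].[u] = 0) v).

Definition const_on a b h := exists c, on_itv a b (fun x => h x = c).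

Definition nowhere_const a b h :=
  forall c d, a <= c -> c < d -> d <= b -> ~ const_on c d h.

Definition vanishes_on a b h q := on_itv a b (fun x => q.[(h x)%:P].[x] = 0).

(** Lexicographic comparison of the degree in [z] and the degree in [x] of the leading
    coefficient. *)
Definition smaller (p q : {poly {poly R}}) : Prop :=
  (size p < size q)%N \/
  size p = size q /\ (size (lead_coef p) < size (lead_coef q))%N.

Lemma on_itv_sub a b c d (P : R -> Prop) :
  a <= c -> d <= b -> on_itv a b P -> on_itv c d P.
Proof.
by move=> ac db Pab x cx xd; apply: Pab; [exact: le_lt_trans cx|exact: lt_le_trans xd
  _].
Qed.

Lemma nowhere_const_sub a b c d h :
  a <= c -> d <= b -> nowhere_const a b h -> nowhere_const c d h.
Proof. by move=> ac db nc u v cu uv vd; apply: nc => //; [exact: le_trans cu|exact: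
  le_trans db]. Qed.

(** Each point of [l] is avoided by passing to one half of the current interval. *)
Lemma itv_avoid (l : seq R) a b : a < b ->
  exists c d, [/\ a <= c, c < d, d <= b & on_itv c d (fun x => x \notin l)].
Proof.
elim: l a b => [|y l IH] a b ab; first by exists a, b; split.
have [am mb] := midf_lt ab; set m := _ / _ in am mb.
have [ym|my] := leP y m.
  have [c [d [mc cd db cdl]]] := IH _ _ mb.
  exists c, d; split=> //; first exact: le_trans (ltW am) mc.
  move=> x cx xd; rewrite inE negb_or cdl // andbT gt_eqF //.
  by apply: le_lt_trans cx; apply: le_trans mc.
have [c [d [ac cd dm cdl]]] := IH _ _ am.
exists c, d; split=> //; first exact: le_trans dm (ltW mb).
move=> x cx xd; rewrite inE negb_or cdl // andbT lt_eqF //.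
by apply: lt_le_trans xd _; apply: le_trans dm (ltW my).
Qed.

Lemma exists_least (P : nat -> Prop) n : P n ->
  exists m, P m /\ forall k, (k < m)%N -> ~ P k.
Proof.
elim: n {-2}n (leqnn n) => [|n IH] m lm Pm.
  by exists m; split=> // k; move: lm; rewrite leqn0 => /eqP ->.
have [[k [km Pk]]|nk] := classic (exists k, (k < m)%N /\ P k).
  by apply: IH Pk; rewrite -ltnS; apply: leq_trans lm.
by exists m; split=> // k km Pk; apply: nk; exists k.
Qed.

(** Competitors may vanish on a smaller interval only, so minimality is inherited by
    subintervals. *)
Definition minimal_poly a b h (Q : {poly {poly R}}) := [/\ Q != 0, vanishes_on a b h Q &
  forall c d q, a <= c -> c < d -> d <= b -> q != 0 -> vanishes_on c d h q ->
    ~ smaller q Q].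

(** Two successive minimizations, each allowed to shrink the interval: first of the degree in [z],
    then of the degree in [x] of the leading coefficient. *)
Lemma exists_minimal_poly a b h : a < b -> tame_fun h ->
  exists c d Q, [/\ a <= c, c < d, d <= b & minimal_poly c d h Q].
Proof.
move=> ab [[Q Q0 hQ] _].
pose P1 n := exists c d q, [/\ a <= c, c < d, d <= b &
  [/\ q != 0, vanishes_on c d h q & size q = n]].
have [m [[c [d [q [ac cd db [q0 hq sq]]]]] m_least]] : exists m, P1 m /\
    forall k, (k < m)%N -> ~ P1 k.
  apply: (@exists_least P1 (size Q)); exists a, b, Q; split=> //; split=> // x _ _.
pose P2 n := exists c' d' q, [/\ c <= c', c' < d', d' <= d &
  [/\ q != 0, vanishes_on c' d' h q, size q = m & size (lead_coef q) = n]].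
have [k [[c' [d' [q' [cc' cd' dd' [q0' hq' sq' lq']]]]] k_least]] : exists k, P2 k /\
    forall j, (j < k)%N -> ~ P2 j.
  apply: (@exists_least P2 (size (lead_coef q))); exists c, d, q; split=> //.
exists c', d', q'; split; try by [|apply: le_trans ac _|apply: le_trans dd' _].
split=> // u v r cu uv vd r0 hr [lt_r|[er lt_r]].
  apply: (m_least (size r)); first by rewrite -sq'.
  exists u, v, r; split=> //; first by do 2?apply: le_trans; eauto.
  by do 2?apply: le_trans; eauto.
apply: (k_least (size (lead_coef r))); first by rewrite -lq'.
exists u, v, r; split=> //; [exact: le_trans cu|exact: le_trans dd'|].
by split=> //; rewrite er.
Qed.

(** A zero of [q] on the graph outside the exceptions granted by tameness would spread to an
    interval, against the minimality of [Q]. *)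
Lemma minimal_polyP a b h Q q (T : R -> Prop) :
  a < b -> tame_fun h -> minimal_poly a b h Q -> q != 0 -> smaller q Q ->
  (forall x, T x -> [/\ a < x, x < b & q.[(h x)%:P].[x] = 0]) ->
  exists l : seq R, forall x, T x -> x \in l.
Proof.
move=> ab [_ ht] [_ _ minQ] q0 qQ Tq; have [l lP] := ht q.
exists l => x /Tq[ax xb qx]; apply: contraT => /lP /(_ qx) nx.
have {nx} [c [d [cx xd qcd]]] := nx.
case: (minQ (Num.max a c) (Num.min b d) q); rewrite ?le_max ?ge_min ?lexx //.
  by apply: (@lt_trans _ _ x); rewrite ?gt_max ?lt_min ?ax ?cx ?xb ?xd.
move=> u; rewrite gt_max lt_min => /andP[_ cu] /andP[_ ud]; exact: qcd.
Qed.

(** If all coefficients were constant in [x], every h(x) would be a root of one polynomial [P] over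
    [R]. Dividing [P] by z - h(m) gives a smaller polynomial, which vanishes at h(x) for finitely
    many [x] only; hence h = h(m) on some subinterval. *)
Lemma exists_nonconst_coef a b h Q :
  a < b -> tame_fun h -> minimal_poly a b h Q -> nowhere_const a b h ->
  exists i, (1 < size (Q`_i)%R)%N.
Proof.
move=> ab ht mQ nch; have [Q0 hQ minQ] := mQ; apply: NNPP => nex.
pose P := map_poly (horner_eval 0) Q.
have QP : Q = map_poly polyC P.
  apply/polyP => i; rewrite coef_map /= coef_map /= /horner_eval.
  have /size1_polyC -> : (size (Q`_i)%R <= 1)%N by rewrite leqNgt; apply/negP => lt_i;
    apply: nex; exists i.
  by rewrite hornerC.
have PE (p : {poly R}) z x : (map_poly polyC p).[z%:P].[x] = p.[z].
  by rewrite horner_map hornerC.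
have P0 : P != 0 by apply: contra_neq Q0 => P0; rewrite QP P0 rmorph0.
have [am mb] := midf_lt ab; set m := _ / _ in am mb.
have /eqP := hQ m am mb; rewrite QP PE => /factor_theorem[P1 P1E].
have P10 : P1 != 0 by apply: contra_neq P0 => P10; rewrite P1E P10 mul0r.
pose q1 : {poly {poly R}} := map_poly polyC P1.
have [l lP] : exists l : seq R, forall x, [/\ a < x, x < b & q1.[(h x)%:P].[x] = 0] ->
  x \in l.
  apply: (minimal_polyP ab ht mQ (q := q1)) => //.
    by rewrite map_polyC_eq0.
  left; rewrite QP !size_map_polyC P1E size_Mmonic ?monicXsubC // size_XsubC.
  by rewrite addn2.
have [c [d [ac cd db cdl]]] := itv_avoid l ab.
apply: (nch c d) => //; exists (h m) => x cx xd.
have ax : a < x by apply: le_lt_trans cx.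
have xb : x < b by apply: lt_le_trans db.
have := hQ x ax xb; rewrite QP PE P1E hornerM hornerXsubC => /eqP.
rewrite mulf_eq0 subr_eq0 => /orP[/eqP q1x|/eqP //].
by have /negP[] := cdl x cx xd; apply: lP; split=> //; rewrite PE.
Qed.

End TameFunctions.

(** * Coefficients after an affine substitution *)

Section AffineComp.
Variable R : rcfType.
Implicit Types (p : {poly R}) (x w : R).

(** Taylor expansion of [p] at [x]; the normalized derivative absorbs the factorial. *)
Lemma coef_comp_affine p x w i :
  (p \Po (x%:P + w *: 'X))`_i = p^`N(i).[x] * w ^+ i.
Proof.
have -> : p \Po (x%:P + w *: 'X) = (map_poly polyC p).[x%:P + w *: 'X] by [].
rewrite nderiv_taylor; last exact: mulrC.
rewrite size_map_polyC.
under eq_bigr => j _ do rewrite nderivn_map horner_map /= exprZn mulrC -scalerAl mulrC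
  mul_polyC scalerA.
rewrite coef_sum; under eq_bigr => j _ do rewrite coefZ coefXn.
have [li|li] := ltnP i (size p).
  rewrite (bigD1 (Ordinal li)) //= eqxx mulr1 big1 ?addr0 1?mulrC // => j /negPf ji.
  by rewrite eq_sym -val_eqE /= in ji; rewrite ji mulr0.
rewrite big1; last by move=> j _; rewrite gtn_eqF ?mulr0 // (leq_trans (ltn_ord j)).
by rewrite nderivn_poly0 // horner0 mul0r.
Qed.

(** For degree at most k+1 the normalized derivative of order k is at most linear. Comparing this
    coefficient with the top one reveals [x + center p]. *)
Lemma coef_comp_affine_subtop p x w k : (size p <= k.+2)%N ->
  (p \Po (x%:P + w *: 'X))`_k = (p`_k + x * (p`_k.+1 *+ k.+1)) * w ^+ k.
Proof.
move=> sp; rewrite coef_comp_affine; congr (_ * _).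
have -> : p^`N(k) = (p`_k)%:P + (p`_k.+1 *+ k.+1) *: 'X.
  apply/polyP => -[|[|i]]; rewrite coef_nderivn coefD coefC coefZ coefX /=.
  - by rewrite addn0 binn mulr1n mulr0 addr0.
  - by rewrite addn1 binSn mulr1 add0r.
  - by rewrite mulr0 addr0 nth_default ?mul0rn // !addnS (leq_trans sp) // !ltnS
    leq_addr.
by rewrite hornerD hornerC hornerZ hornerX [x * _]mulrC.
Qed.

Lemma coef_comp_affine_top p x w k : (size p <= k.+1)%N ->
  (p \Po (x%:P + w *: 'X))`_k = p`_k * w ^+ k.
Proof.
move=> sp; rewrite coef_comp_affine_subtop ?(leq_trans sp) //.
by rewrite [p`_k.+1]nth_default // mul0rn mulr0 addr0.
Qed.

Lemma size_affine x w : w != 0 -> size (x%:P + w *: 'X) = 2%N.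
Proof.
by move=> w0; rewrite addrC size_polyDl size_scale // size_polyX // size_polyC ltnS
  leq_b1.
Qed.

End AffineComp.

(** * Parameters in F at which a function takes values in F *)

Section Fibers.
Variables (R : rcfType) (F : R -> Prop).
Hypothesis FF : is_subfield F.
Implicit Types (a b x w t : R) (h : R -> R) (Q : {poly {poly R}}).

(* Minus the mean of the roots of [p], when [p] is not constant. *)
Definition center (p : {poly R}) : R :=
  p`_(size p).-2 / (p`_(size p).-1 *+ (size p).-1).

(** For [t] and z = h(x + t w) in F, the equation Q(x + t w, z) = 0 is an F-linear relation between
    the normalized coefficients [c]. A functional that kills 1 but not all of [c] turns it into the
    vanishing of a smaller polynomial, possible at finitely many points of the graph only. *)
Lemma subfield_fiber_finite a b h Q x w i :
  a < b -> tame_fun h -> minimal_poly a b h Q -> (1 < size (Q`_i)%R)%N ->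
  w != 0 -> ~ F ((x + center Q`_i) / w) ->
  exists l : seq R, forall t, F t -> a < x + t * w -> x + t * w < b ->
    F (h (x + t * w)) -> t \in l.
Proof.
move=> ab ht mQ si w0 nF; have [Q0 hQ _] := mQ.
(* [al] substitutes x + t w for the argument, and [be] is the inverse substitution. *)
pose al := x%:P + w *: 'X; pose be := (- x / w)%:P + w^-1 *: 'X.
have sal : size al = 2%N by apply: size_affine.
have sbe : size be = 2%N by apply: size_affine; rewrite invr_eq0.
pose N := (size Q + \max_(j < size Q) size (Q`_j)%R)%N.
have sN j : (size (Q`_j)%R <= N)%N.
  have [lj|lj] := ltnP j (size Q); last by rewrite [Q`_j]nth_default // size_poly0.
  by apply: leq_trans (leq_addl _ _); apply: (leq_bigmax (Ordinal lj)).
have sQN : (size Q <= N)%N by apply: leq_addr.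
pose e0 := (size Q).-1; pose k0 := (size (lead_coef Q)).-1.
have sQ : size Q = e0.+1 by rewrite prednK // size_poly_gt0.
have lQ0 : lead_coef Q != 0 by rewrite lead_coef_eq0.
have slQ : size (lead_coef Q) = k0.+1 by rewrite prednK // size_poly_gt0.
(* The leading coefficient, in [z] and then in [t], of Q(x + t w, z); dividing by it makes the
   coefficient at [u0] equal to 1. *)
pose lam := (lead_coef (lead_coef Q)) * w ^+ k0.
have lam0 : lam != 0 by rewrite mulf_neq0 ?expf_neq0 ?lead_coef_eq0.
pose c (u : 'I_N.+1 * 'I_N.+1) := (Q`_(u.1) \Po al)`_(u.2) / lam.
have le0 : (e0 < N.+1)%N by rewrite -sQ (leq_trans sQN).
have lk0 : (k0 < N.+1)%N by rewrite -slQ (leq_trans (sN _)).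
pose u0 : 'I_N.+1 * 'I_N.+1 := (inord e0, inord k0).
have c0 : c u0 = 1.
  rewrite /c /= !inordK // -/(lead_coef Q) coef_comp_affine_top ?slQ //.
  by rewrite divff.
(* If all normalized coefficients lie in F, so does the quotient of the two top coefficients in [t]
   of the coefficient of index [i]; divided by the degree it is (x + center) / w. *)
have [allF|/not_all_ex_not[u1 cu1]] := classic (forall u, F (c u)).
  case: nF; set p := Q`_i in si *.
  have [d sp] : exists d, size p = d.+2 by case: (size p) si => [|[|d]] // _; exists d.
  have li : (i < N.+1)%N.
    rewrite ltnS (leq_trans _ sQN) // ltnW // ltnNge; apply/negP => li.
    by move: si; rewrite /p nth_default // size_poly0.
  have ld : (d.+1 < N.+1)%N by rewrite -sp ltnW // ltnS sN.
  have := allF (inord i, inord d.+1); rewrite /c /= !inordK // -/p.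
  rewrite coef_comp_affine_top ?sp // => Ftop.
  have := allF (inord i, inord d); rewrite /c /= !inordK //; last by rewrite ltnW.
  rewrite -/p coef_comp_affine_subtop ?sp // => Fsub.
  have pd0 : p`_d.+1 != 0.
    by have := lead_coef_eq0 p; rewrite /lead_coef sp /= => ->; rewrite -size_poly_eq0
      sp.
  have d0 : (d.+1%:R : R) != 0 by rewrite pnatr_eq0.
  have -> : (x + center p) / w = ((p`_d + x * (p`_d.+1 *+ d.+1)) * w ^+ d / lam) /
      (p`_d.+1 * w ^+ d.+1 / lam) / d.+1%:R.
    have wd0 : w ^+ d != 0 by rewrite expf_neq0.
    rewrite /center sp /= exprS -(mulr_natr p`_d.+1).
    by move: (d.+1%:R : R) d0 => D d0; field; rewrite d0 pd0 lam0 w0 wd0.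
  by apply: sf_div => //; [apply: sf_div|apply: sf_nat].
have [d [d0 d1 dP]] := separating_functional FF c0 cu1.
(* Vanishing coefficients stay zero, so applying [d] raises no degree. *)
have dc u : c u = 0 -> d u = 0.
  have sumE (g : 'I_N.+1 * 'I_N.+1 -> R) : \sum_v (v == u)%:R * g v = g u.
    rewrite (bigD1 u) //= eqxx mul1r big1 ?addr0 // => v /negPf ->.
    by rewrite mul0r.
  move=> cu; rewrite -sumE; apply: dP; last by rewrite sumE.
  by move=> v; apply: sf_nat.
pose r i : {poly R} := \poly_(j < N.+1) d (inord i, inord j).
pose q : {poly {poly R}} := \poly_(i < N.+1) (r i \Po be).
have pairE (g : 'I_N.+1 * 'I_N.+1 -> R) : \sum_u g u = \sum_i \sum_j g (i, j).
  by rewrite pair_bigA; apply: eq_bigr => -[].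
have qE z t : q.[z%:P].[x + t * w] = \sum_(u : 'I_N.+1 * 'I_N.+1) (t ^+ u.2 * z ^+
  u.1) * d u.
  have bet : be.[x + t * w] = t by rewrite !hornerE; field.
  rewrite horner_poly horner_sum.
  rewrite pairE /=.
  apply: eq_bigr => j _; rewrite hornerM horner_comp bet horner_poly.
  rewrite -rmorphXn /= hornerC mulr_suml; apply: eq_bigr => k _.
  by rewrite !inord_val -mulrA mulrC.
have QE z t : Q.[z%:P].[x + t * w] = lam * \sum_(u : 'I_N.+1 * 'I_N.+1) (t ^+ u.2 * z
  ^+ u.1) * c u.
  have alt : al.[t] = x + t * w by rewrite !hornerE mulrC.
  rewrite (horner_coef_wide _ (leqW sQN)) horner_sum.
  rewrite pairE /=.
  rewrite mulr_sumr; apply: eq_bigr => j _; rewrite hornerM -alt -horner_comp.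
  rewrite -rmorphXn /= hornerC (@horner_coef_wide _ N.+1); last first.
    by rewrite size_comp_poly2 // leqW.
  rewrite mulr_suml mulr_sumr; apply: eq_bigr => k _; rewrite /c /=.
  by field.
(* The coefficient at [u1] has become 1. *)
have q0 : q != 0.
  apply/eqP => /(congr1 (fun q : {poly {poly R}} => q`_u1.1)).
  rewrite coef0 coef_poly ltn_ord => /eqP; rewrite comp_poly2_eq0 // => /eqP.
  move/(congr1 (fun p : {poly R} => p`_u1.2)); rewrite coef0 coef_poly ltn_ord.
  rewrite !inord_val -surjective_pairing d1 => /eqP; by rewrite oner_eq0.
(* If the degree in [z] is unchanged, the former leading term is removed by [d u0 = 0]. *)
have qQ : smaller q Q.
  have sq : (size q <= size Q)%N.
    apply/leq_sizeP => j lj; rewrite coef_poly; case: ltnP => // ljN.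
    suff -> : r j = 0 by rewrite comp_poly0.
    apply/polyP => k; rewrite coef0 coef_poly; case: ltnP => // lk; apply: dc.
    by rewrite /c /= !inordK // [Q`_j]nth_default // comp_poly0 coef0 mul0r.
  move: sq; rewrite leq_eqVlt => /orP[/eqP sq|]; [right|by left]; split=> //.
  rewrite lead_coefE sq -/e0 coef_poly le0 size_comp_poly2 // slQ ltnS.
  apply/leq_sizeP => k; rewrite leq_eqVlt coef_poly => /orP[/eqP <-|lk].
    by rewrite lk0.
  case: ltnP => // lkN; apply: dc; rewrite /c /= !inordK // -/(lead_coef Q).
  by rewrite nth_default ?mul0r // size_comp_poly2 // slQ.
pose T y := exists t, [/\ y = x + t * w, F t, F (h y), a < y & y < b].
have [l lP] : exists l : seq R, forall y, T y -> y \in l.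
  apply: (minimal_polyP ab ht mQ q0 qQ) => _ [t [-> Ft Fh at_ tb]]; split=> //.
  rewrite qE; apply: dP.
    by move=> u; apply: sfM => //; apply: sfX.
  by apply: (mulfI lam0); rewrite mulr0 -QE hQ.
exists (map (fun y => (y - x) / w) l) => t Ft at_ tb Fh.
apply/mapP; exists (x + t * w); last by field.
by apply: lP; exists t.
Qed.

End Fibers.

(** * Simultaneous avoidance of F by several functions *)

Section Avoidance.
Variables (R : rcfType) (F : R -> Prop).
Hypothesis FP : proper_subfield F.
Let FF : is_subfield F. Proof. by case: FP. Qed.
Implicit Types (a b x w t : R) (h : R -> R).

(** The shifts [cs] are fixed before [x] and [w], so that one choice of these can serve all
    functions of the list. *)
Lemma exists_shared_itv (hs : list (R -> R)) a b : a < b ->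
  (forall h, List.In h hs -> tame_fun h /\ nowhere_const a b h) ->
  exists a' b' (cs : seq R), [/\ a <= a', a' < b', b' <= b &
    forall h, List.In h hs -> exists2 s, s \in cs &
      forall x w, w != 0 -> ~ F ((x + s) / w) ->
      exists l : seq R, forall t, F t -> a' < x + t * w -> x + t * w < b' ->
        F (h (x + t * w)) -> t \in l].
Proof.
elim: hs a b => [|h hs IH] a b ab hsP; first by exists a, b, [::]; split.
have [a1 [b1 [cs [aa1 ab1 bb1 csP]]]] := IH a b ab (fun g gs => hsP g (or_intror gs)).
have [ht nch] : tame_fun h /\ nowhere_const a b h by apply: hsP; left.
have [a2 [b2 [Q [aa2 ab2 bb2 mQ]]]] := exists_minimal_poly ab1 ht.
have nch2 : nowhere_const a2 b2 h.
  by apply: nowhere_const_sub nch; [exact: le_trans aa2|exact: le_trans bb1].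
have [i si] := exists_nonconst_coef ab2 ht mQ nch2.
exists a2, b2, (center Q`_i :: cs); split=> //.
- exact: le_trans aa2.
- exact: le_trans bb1.
move=> g [<-|gs].
  exists (center Q`_i); first by rewrite mem_head.
  by move=> x w w0 nF; apply: subfield_fiber_finite nF.
have [s ss sP] := csP g gs; exists s; first by rewrite inE ss orbT.
move=> x w w0 nF; have [l lP] := sP x w w0 nF; exists l => t Ft tx xt.
by apply: lP => //; [exact: le_lt_trans tx|exact: lt_le_trans xt _].
Qed.

Lemma subfield_invn n : F (n.+1%:R^-1).
Proof. by apply: sfV => //; apply: sf_nat. Qed.

Lemma invn_inj : injective (fun n : nat => (n.+1%:R^-1 : R)).
Proof. by move=> m n /invr_inj /eqP; rewrite eqr_nat => /eqP[]. Qed.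

Lemma exists_small_notin : exists2 r, ~ F r & `|r| <= 1.
Proof.
have [_ [r nr]] := FP; have [|/ltW r1] := leP `|r| 1; first by exists r.
exists r^-1; first by move/(sfV FF); rewrite invrK.
by rewrite normfV invf_le1 //; apply: lt_le_trans r1.
Qed.

(** The candidates are the multiples of [e] by [u n]. As 1 and [r] are linearly independent over F,
    [u m / u n] is in F only for m = n; so each [b] excludes at most one [n]. *)
Lemma exists_direction (bs : seq R) (e : R) : all (fun b => b != 0) bs -> 0 < e ->
  exists w, [/\ w != 0, `|w| <= 2%:R * e & forall b, b \in bs -> ~ F (b / w)].
Proof.
move=> bs0 e0; have [r nr r1] := exists_small_notin.
pose u n : R := 1 + n.+1%:R^-1 * r.
have u0 n : u n != 0.
  apply/eqP => un; apply: nr.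
  have -> : r = - n.+1%:R; last by apply: sfN => //; apply: sf_nat.
  have n0 : (n.+1%:R : R) != 0 by rewrite pnatr_eq0.
  apply: (mulfI (invr_neq0 n0)); rewrite mulrN mulVf //.
  by move/eqP: un; rewrite /u addrC addr_eq0 => /eqP.
have u_quot m n : F (u m / u n) -> m = n.
  move=> Fq; apply: invn_inj => /=.
  have E : u m = u m / u n * u n by rewrite divfK.
  move: Fq E; move: (u m / u n) => f Ff.
  rewrite /u; have Fm := subfield_invn m; have Fn := subfield_invn n.
  move: (m.+1%:R^-1) (n.+1%:R^-1) Fm Fn => s s' Fs Fs' E.
  have [fs|fs] := eqVneq (f * s') s; last first.
    case: nr; have -> : r = (1 - f) / (f * s' - s).
      apply: (canRL (mulfK _)); first by rewrite subr_eq0.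
      by move: E; lra.
    by apply: sf_div => //; apply: sfB => //; [exact: sf1|exact: sfM].
  have f1 : f = 1 by rewrite -fs in E; lra.
  by rewrite -fs f1 mul1r.
have [l lP] : exists l : seq nat, forall n, n \notin l -> forall b, b \in bs ->
    ~ F (b / (e * u n)).
  elim: bs bs0 => [|b bs IH] /=; first by exists [::].
  case/andP=> b0 /IH [l lP].
  have [[m Fm]|nm] := classic (exists m, F (b / (e * u m))); last first.
    exists l => n nl c; rewrite inE => /orP[/eqP -> Fc|]; last exact: lP.
    by apply: nm; exists n.
  exists (m :: l) => n; rewrite inE negb_or => /andP[nm nl] c.
  rewrite inE => /orP[/eqP -> Fn|]; last exact: lP.
  move/eqP: nm; apply; symmetry.
  apply: u_quot; have -> : u m / u n = (b / (e * u n)) / (b / (e * u m)).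
    by field; rewrite !u0 b0 gt_eqF.
  exact: sf_div.
have [n nl] := injective_notin l (@inj_id nat).
exists (e * u n); split; [by rewrite mulf_neq0 ?u0 // gt_eqF| |exact: lP].
rewrite normrM gtr0_norm // mulrC ler_pM2r //.
apply: le_trans (ler_normD _ _) _; rewrite normr1 normrM.
rewrite [2%:R]mulr2n lerD2l mulr_ile1 // ger0_norm ?invr_ge0 ?ler0n //.
by rewrite invf_le1 ?ltr0Sn // ler1n.
Qed.

Lemma finite_union_preds (hs : list (R -> R)) (P : (R -> R) -> R -> Prop) :
  (forall h, List.In h hs -> exists l : seq R, forall t, P h t -> t \in l) ->
  exists l : seq R, forall h, List.In h hs -> forall t, P h t -> t \in l.
Proof.
elim: hs => [|h hs IH] hP; first by exists [::].
have [l lP] := IH (fun g gs => hP g (or_intror gs)).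
have [l' l'P] := hP h (or_introl erefl).
exists (l' ++ l) => g [<-|gs] t Pt; rewrite mem_cat ?(l'P _ Pt) //.
by rewrite (lP _ gs _ Pt) orbT.
Qed.

(** First [x] is chosen off the points [- s], so that a direction [w] exists; then t = 1/(n+1) is
    taken outside finitely many bad values. *)
Lemma exists_all_notin (hs : list (R -> R)) a b : a < b ->
  (forall h, List.In h hs -> tame_fun h /\ nowhere_const a b h) ->
  exists x, [/\ a < x, x < b & forall h, List.In h hs -> ~ F (h x)].
Proof.
move=> ab /(exists_shared_itv ab) [a' [b' [cs [aa' ab' bb' csP]]]].
have [c [d [ac cd db avoid]]] := itv_avoid (map -%R cs) ab'.
have [cm md] := midf_lt cd; set x := _ / _ in cm md.
have xcs : all (fun b => b != 0) (map (+%R x) cs).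
  apply/allP => _ /mapP[s ss ->]; rewrite addr_eq0.
  by apply: contraNneq (avoid x cm md) => ->; apply: map_f.
(* The point will move by at most 2e, and 3e is the distance from [x] to the nearer end of the
   interval. *)
pose e := Num.min (x - c) (d - x) / 3%:R.
have e0 : 0 < e by rewrite divr_gt0 ?ltr0n // lt_min !subr_gt0 cm md.
have [w [w0 we wP]] := exists_direction xcs e0.
have [l lP] : exists l : seq R, forall h, List.In h hs -> forall t,
    [/\ F t, a' < x + t * w, x + t * w < b' & F (h (x + t * w))] -> t \in l.
  apply: finite_union_preds => h hs_h; have [s ss sP] := csP h hs_h.
  have [|l lP] := sP x w w0; first by apply: wP; apply: map_f.
  by exists l => t [Ft at_ tb Fh]; apply: lP.
have [n nl] := injective_notin l invn_inj.
have [cx xd] : c < x + n.+1%:R^-1 * w /\ x + n.+1%:R^-1 * w < d.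
  have : `|n.+1%:R^-1 * w| < 3%:R * e.
    rewrite normrM ger0_norm ?invr_ge0 ?ler0n //.
    apply: (@le_lt_trans _ _ `|w|); last by apply: le_lt_trans we _; rewrite ltr_pM2r
      // ltr_nat.
    by rewrite ler_piMl // invf_le1 ?ltr0Sn // ler1n.
  rewrite /e mulrCA divff ?pnatr_eq0 // mulr1 lt_min !ltr_norml.
  by move: (_ * w) => y /andP[/andP[h1 _] /andP[_ h2]]; split; lra.
exists (x + n.+1%:R^-1 * w).
have a'x := le_lt_trans ac cx; have xb' := lt_le_trans xd db.
split; [exact: le_lt_trans a'x|exact: lt_le_trans bb'|] => h hs_h Fh.
by case/negP: nl; apply: (lP h hs_h); split=> //; apply: subfield_invn.
Qed.

(** The identity joins the functions under consideration so that the point [x] itself is made to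
    avoid F. *)
Lemma tame_id : tame_fun (@id R).
Proof.
split.
  exists ('X - 'X%:P); first by rewrite polyXsubC_eq0.
  by move=> x; rewrite hornerXsubC hornerD hornerN hornerX hornerC subrr.
move=> q; pose p := q.['X].
have pE v : q.[v%:P].[v] = p.[v].
  rewrite /p -[LHS]/(horner_eval v _) -[RHS]/(horner_eval v _) -!horner_map /=.
  by rewrite /horner_eval hornerX hornerC.
exists (polyrcf.rootsR p) => v vl; rewrite pE => pv.
have [p0|p0] := eqVneq p 0.
  by apply: near_sub (nearT v) => u _; rewrite pE p0 horner0.
by case/negP: vl; rewrite -(polyrcf.roots_on_rootsR p0) inE /= /root pv.
Qed.

Lemma nowhere_const_id a b : nowhere_const a b (@id R).
Proof.
move=> c d _ cd _ [y yP]; have [cm md] := midf_lt cd.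
have [cn nm] := midf_lt cm.
by have := yP _ cm md; rewrite -(yP _ cn (lt_trans nm md)) => e; rewrite {2}e ltxx in
  nm.
Qed.

End Avoidance.

(** * Elimination of one variable *)

Section OneVariable.
Variable R : rcfType.
Implicit Types (a b c x : R) (h : R -> R) (E : R -> Prop) (hs : list (R -> R)).

Definition locally_constant_value h c :=
  exists a b, a < b /\ on_itv a b (fun x => h x = c).

(** If all [y] in an interval were locally constant values, each Q(x, y) would vanish on an interval
    of [x], hence identically in [x]; then [Q] would have infinitely many roots in [z]. *)
Lemma locally_constant_value_isolated h c :
  tame_fun h -> ~ near (locally_constant_value h) c.
Proof.
move=> [[Q Q0 hQ] _] [p [q [pc cq pq]]].
have root_val y : p < y -> y < q -> root Q y%:P.
  move=> py yq; have [a [b [ab hy]]] := pq y py yq; apply/eqP.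
  apply/eqP; apply: contraT => Qy.
  have [u [v [au uv vb uvQ]]] := itv_avoid (polyrcf.rootsR Q.[y%:P]) ab.
  have [um mv] := midf_lt uv; set m := _ / _ in um mv.
  have hm : h m = y by apply: hy; [exact: le_lt_trans um|exact: lt_le_trans vb].
  have /negP[] := uvQ m um mv.
  by rewrite -(polyrcf.roots_on_rootsR Qy) inE /= /root -hm hQ.
(* Distinct points strictly between [p] and [q]; the denominators start at 2 to stay below [q]. *)
pose u n : R := p + (q - p) / n.+2%:R.
have qp0 : 0 < q - p by rewrite subr_gt0 (lt_trans pc).
have ui : injective u.
  move=> m n /addrI /(mulfI (lt0r_neq0 qp0)) /invr_inj /eqP.
  by rewrite eqr_nat => /eqP[].
have /(max_poly_roots Q0) : all (root Q) (map (polyC \o u) (iota 0 (size Q))).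
  apply/allP => _ /mapP[n _ ->]; apply: root_val; rewrite /u.
    by rewrite ltrDl divr_gt0 // ltr0n.
  rewrite -ltrBrDl gtr_pMr // invf_lt1 ?ltr0n // ltr1n.
  by [].
by rewrite map_inj_uniq ?iota_uniq ?size_map ?size_iota ?ltnn => [/(_ isT)|m n
  /polyC_inj /ui].
Qed.

Definition exceptional E hs x := E x /\ ~ exists a b, [/\ a < x, x < b,
  on_itv a b E & forall h, List.In h hs -> const_on a b h \/ nowhere_const a b h].

(** Shrink to an interval where the function is constant if there is one; otherwise it is nowhere
    constant already. *)
Lemma exists_regular_itv hs a b : a < b -> exists c d, [/\ a <= c, c < d, d <= b &
  forall h, List.In h hs -> const_on c d h \/ nowhere_const c d h].
Proof.
elim: hs a b => [|h hs IH] a b ab; first by exists a, b; split.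
have [[c [d [ac cd db hcd]]]|nh] := classic (exists c d,
    [/\ a <= c, c < d, d <= b & const_on c d h]).
  have [u [v [cu uv vd hsP]]] := IH c d cd.
  exists u, v; split=> //; [exact: le_trans cu|exact: le_trans db|].
  move=> g [<-|/hsP //]; left; have [y hy] := hcd; exists y.
  exact: on_itv_sub hy.
have [u [v [au uv vb hsP]]] := IH a b ab.
exists u, v; split=> // g [<-|/hsP //]; right=> c d uc cd dv hcd; apply: nh.
by exists c, d; split=> //; [exact: le_trans uc|exact: le_trans vb].
Qed.

(** An interval of exceptional points lies in [E] and contains a regular subinterval, whose points
    are then not exceptional. *)
Lemma exceptional_isolated E hs x : ~ near (exceptional E hs) x.
Proof.
move=> [a [b [ax xb Tab]]].
have [c [d [ac cd db hsP]]] := exists_regular_itv hs (lt_trans ax xb).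
have [cm md] := midf_lt cd; set m := _ / _ in cm md.
have [Em] : exceptional E hs m.
  by apply: Tab; [exact: le_lt_trans cm|exact: lt_le_trans db].
case; exists c, d; split=> // u cu ud.
by have [] : exceptional E hs u by apply: Tab; [exact: le_lt_trans cu|exact:
  lt_le_trans db].
Qed.

(** A point of [E] that is not exceptional has a regular interval around it, and a function constant
    there has its value outside F because that value is taken at the point. Conversely, on such an
    interval [exists_all_notin] treats the identity and the nowhere constant functions. *)
Lemma one_variable_step (F : R -> Prop) E hs : proper_subfield F ->
  (forall h, List.In h hs -> tame_fun h) ->
  (exists x, [/\ ~ F x, E x & forall h, List.In h hs -> ~ F (h x)]) <->
  (exists x, [/\ exceptional E hs x, ~ F x, E x & forall h, List.In h hs -> ~ F (h
    x)]) \/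
  (exists a b, [/\ a < b, on_itv a b E & forall h, List.In h hs ->
    nowhere_const a b h \/ exists c, ~ F c /\ on_itv a b (fun x => h x = c)]).
Proof.
move=> FP hsT; split.
  move=> [x [nFx Ex hx]].
  have [Tx|nTx] := classic (exceptional E hs x); first by left; exists x.
  right; have [[a [b [ax xb Eab hsP]]]|nab] := classic (exists a b, [/\ a < x, x < b,
      on_itv a b E & forall h, List.In h hs -> const_on a b h \/ nowhere_const a b
        h]); last first.
    by case: nTx.
  exists a, b; split=> //; first exact: lt_trans xb.
  move=> h hs_h; have [[c hc]|] := hsP h hs_h; last by left.
  by right; exists c; split=> //; rewrite -(hc x ax xb); apply: hx.
move=> [[x [_ nFx Ex hx]]|[a [b [ab Eab hsP]]]]; first by exists x.
(* [ws] keeps the nowhere constant functions; the others avoid F on the whole interval. *)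
have [ws wsP] : exists ws : list (R -> R),
    (forall h, List.In h ws -> tame_fun h /\ nowhere_const a b h) /\
    forall x, a < x -> x < b -> (forall h, List.In h ws -> ~ F (h x)) ->
      forall h, List.In h hs -> ~ F (h x).
  elim: hs hsT hsP => [|h hs IH] hsT hsP; first by exists nil; split.
  have [ws [ws1 ws2]] := IH (fun g gs => hsT g (or_intror gs)) (fun g gs => hsP g
    (or_intror gs)).
  have [nh|[c [nFc hc]]] := hsP h (or_introl erefl).
    exists (h :: ws); split=> [g [<-|/ws1 //]|x ax xb wsx g].
      by split=> //; apply: hsT; left.
    by case=> [<-|]; [apply: wsx; left|apply: ws2 => // k ks; apply: wsx; right].
  exists ws; split=> // x ax xb wsx g [<-|]; first by rewrite hc.
  exact: ws2.
have [ws1 ws2] := wsP.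
have [x [ax xb hx]] : exists x, [/\ a < x, x < b &
    forall h, List.In h (id :: ws) -> ~ F (h x)].
  apply: exists_all_notin => // h [<-|/ws1 //].
  by split; [exact: tame_id|exact: nowhere_const_id].
exists x; split; [|exact: Eab|].
  by apply: (hx id); left.
by apply: ws2 => // h hws; apply: hx; right.
Qed.

End OneVariable.

(** * Formulas for intervals, constancy and selection *)

Definition reindex (s : seq nat) (m i : nat) : nat :=
  if (i < size s)%N then nth 0%N s i else (i - size s + m)%N.

Lemma reindex_inj s m : uniq s -> all (fun i => i < m)%N s -> injective (reindex s m).
Proof.
move=> us /allP sm i j; rewrite /reindex.
case: ltnP => li; case: ltnP => lj.
- by move/eqP; rewrite nth_uniq // => /eqP.
- by move=> e; have := sm _ (mem_nth 0%N li); rewrite e; lia.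
- by move=> e; have := sm _ (mem_nth 0%N lj); rewrite -e; lia.
- by lia.
Qed.

(** Moves a formula to another context: its first [size s] variables become those listed in [s], and
    its parameters start at [m]. *)
Lemma env_holds_reindex (R : rcfType) (e e' : nat -> R) s m f :
  uniq s && all (fun i => i < m)%N s ->
  (forall i, (i < size s)%N -> e' i = e (nth 0%N s i)) ->
  (forall i, e' (i + size s)%N = e (i + m)%N) ->
  env_holds e (rename (reindex s m) f) <-> env_holds e' f.
Proof.
move=> /andP[us sm] es em; apply: env_holds_rename; first exact: reindex_inj.
move=> i; rewrite /reindex; case: ltnP => li; first exact: es.
by rewrite -em subnK.
Qed.

Definition FLe (t u : oterm) : oformula := FNot (FLt u t).

(* In the comments below the de Bruijn context of a formula is displayed,
   variable 0 first; [e] stands for the parameters. *)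

(* b, a, e *)
Definition FConstOn (H : oformula) : oformula :=
  DEx (DAll (FImp (FLt (TVar 3) (TVar 0)) (FImp (FLt (TVar 0) (TVar 2))
    (rename (reindex [:: 1; 0]%N 4) H)))).

(* b, a, e *)
Definition FNowhereConst (H : oformula) : oformula :=
  DAll (DAll (FImp (FLe (TVar 3) (TVar 1)) (FImp (FLt (TVar 1) (TVar 0))
    (FImp (FLe (TVar 0) (TVar 2))
      (FNot (rename (reindex [:: 0; 1]%N 4) (FConstOn H))))))).

(* b, a, e *)
Definition FOnItv (E : oformula) : oformula :=
  DAll (FImp (FLt (TVar 2) (TVar 0)) (FImp (FLt (TVar 0) (TVar 1))
    (rename (reindex [:: 0]%N 3) E))).

Definition FBigAnd (fs : seq oformula) : oformula := foldr FAnd FTrue fs.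

(* x, e *)
Definition FExceptional (E : oformula) (Hs : seq oformula) : oformula :=
  FAnd E (FNot (DEx (DEx
    (FAnd (FLt (TVar 1) (TVar 2)) (FAnd (FLt (TVar 2) (TVar 0))
    (rename (reindex [:: 0; 1]%N 3) (FAnd (FOnItv E)
      (FBigAnd (map (fun H => FOr (FConstOn H) (FNowhereConst H)) Hs))))))))).

(* c, e *)
Definition FConstValue (H : oformula) : oformula :=
  DEx (DEx (FAnd (FLt (TVar 1) (TVar 0)) (DAll
    (FImp (FLt (TVar 2) (TVar 0)) (FImp (FLt (TVar 0) (TVar 1))
      (rename (reindex [:: 3; 0]%N 4) H)))))).

(* v, e *)
Definition FBelow (P : oformula) : oformula :=
  DEx (FAnd (FLt (TVar 0) (TVar 1)) (rename (reindex [:: 0]%N 2) P)).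

Definition FNonMin (P : oformula) : oformula := FAnd P (FBelow P).

Definition FMin (P : oformula) : oformula := FAnd P (FNot (FBelow P)).

(** The default 0 makes exactly one element satisfy the formula for every choice of parameters, as a
    presentation of a function requires. *)
Definition FMinOr0 (P : oformula) : oformula :=
  FOr (FMin P) (FAnd (FNot (DEx (rename (reindex [:: 0]%N 2) (FMin P))))
    (FEq (TVar 0) TZero)).

(* The [r]-th smallest element of [P], or 0 if there is none. *)
Definition FSelect (P : oformula) (r : nat) : oformula := FMinOr0 (iter r FNonMin P).

(* b, a, e *)
Definition FConstSel (S H : oformula) : oformula :=
  DEx (FAnd (rename (reindex [:: 0]%N 3) S)
    (DAll (FImp (FLt (TVar 3) (TVar 0)) (FImp (FLt (TVar 0) (TVar 2))
      (rename (reindex [:: 1; 0]%N 4) H))))).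

(* z, e *)
Definition FApplySel (S H : oformula) : oformula :=
  DEx (FAnd (rename (reindex [:: 0]%N 2) S) (rename (reindex [:: 1; 0]%N 2) H)).

Section FormulaSemantics.
Variable R : rcfType.
Implicit Types (e : nat -> R) (E H P S f : oformula) (h : R -> R).

Lemma holds_FAnd e f g : env_holds e (FAnd f g) <-> env_holds e f /\ env_holds e g.
Proof. by []. Qed.

Lemma holds_FOr e f g : env_holds e (FOr f g) <-> env_holds e f \/ env_holds e g.
Proof. by []. Qed.

Lemma holds_FNot e f : env_holds e (FNot f) <-> ~ env_holds e f.
Proof. by []. Qed.

Definition defines e H h := forall x z, env_holds (z .: x .: e) H <-> z = h x.

Ltac reindex_tac := apply: env_holds_reindex => //; try (by case=> [|[|[|]]] //);
  try (by move=> ?; rewrite ?addn1 ?addn2 ?addn3 ?addn4).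

Lemma holds_FConstOn e H h a b : defines e H h ->
  env_holds (b .: a .: e) (FConstOn H) <-> const_on a b h.
Proof.
move=> HP; rewrite /FConstOn env_holds_DEx.
have HE c x : env_holds (x .: c .: b .: a .: e) (rename (reindex [:: 1; 0]%N 4) H)
    <-> h x = c.
  have -> : h x = c <-> c = h x by split=> ->.
  by rewrite -HP; reindex_tac.
split=> -[c]; rewrite ?env_holds_DAll => cP; exists c.
  by move=> x ax xb; apply/HE; move: (cP x ax xb).
by rewrite env_holds_DAll => x /= ax xb; apply/HE/cP.
Qed.

Lemma holds_FNowhereConst e H h a b : defines e H h ->
  env_holds (b .: a .: e) (FNowhereConst H) <-> nowhere_const a b h.
Proof.
move=> HP; rewrite /FNowhereConst env_holds_DAll.
have CE c d : env_holds (d .: c .: b .: a .: e)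
    (rename (reindex [:: 0; 1]%N 4) (FConstOn H)) <-> const_on c d h.
  by rewrite -(holds_FConstOn _ _ HP); reindex_tac.
split=> nP c; last first.
  rewrite env_holds_DAll => d /= /negP; rewrite -leNgt => ac cd.
  by move=> /negP; rewrite -leNgt => db /CE; apply: nP.
move=> d ac cd db /CE; move: (nP c); rewrite env_holds_DAll => /(_ d).
by apply=> //=; apply/negP; rewrite -leNgt.
Qed.

Lemma holds_FOnItv e E a b :
  env_holds (b .: a .: e) (FOnItv E) <-> on_itv a b (fun x => env_holds (x .: e) E).
Proof.
rewrite /FOnItv env_holds_DAll.
have EE x : env_holds (x .: b .: a .: e) (rename (reindex [:: 0]%N 3) E) <->
    env_holds (x .: e) E by reindex_tac.
by split=> EP x; have := EP x; rewrite /= EE.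
Qed.

Lemma holds_FBigAnd e fs : env_holds e (FBigAnd fs) <->
  forall f, List.In f fs -> env_holds e f.
Proof.
elim: fs => //= f fs ->; split=> [[hf hfs] g [<-|]|hfs]; auto.
Qed.

Definition defines_all e (Hs : seq oformula) (hs : list (R -> R)) :=
  List.Forall2 (defines e) Hs hs.

Lemma defines_allP e Hs hs (P : oformula -> Prop) (Q : (R -> R) -> Prop) :
  defines_all e Hs hs -> (forall H h, defines e H h -> P H <-> Q h) ->
  (forall H, List.In H Hs -> P H) <-> (forall h, List.In h hs -> Q h).
Proof.
move=> Hhs PQ; elim: Hhs => [|H h Hs' hs' HP _ IH] //=.
split=> [PH g|Qh G] [<-|].
- by apply/(PQ _ _ HP)/PH; left.
- by move: g; apply/IH => G GP; apply: PH; right.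
- by apply/(PQ _ _ HP)/Qh; left.
- by move: G; apply/IH => G GP; apply: Qh; right.
Qed.

Lemma holds_FExceptional e E Hs hs x : defines_all e Hs hs ->
  env_holds (x .: e) (FExceptional E Hs) <->
  exceptional (fun x => env_holds (x .: e) E) hs x.
Proof.
move=> Hhs; rewrite /FExceptional /exceptional holds_FAnd holds_FNot env_holds_DEx.
suff bodyP a b : env_holds (b .: a .: x .: e)
    (FAnd (FLt (TVar 1) (TVar 2)) (FAnd (FLt (TVar 2) (TVar 0))
    (rename (reindex [:: 0; 1]%N 3) (FAnd (FOnItv E)
      (FBigAnd (map (fun H => FOr (FConstOn H) (FNowhereConst H)) Hs)))))) <->
    [/\ a < x, x < b, on_itv a b (fun x => env_holds (x .: e) E) &
     forall h, List.In h hs -> const_on a b h \/ nowhere_const a b h].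
  split=> -[Ex nab]; split=> //.
    by move=> [a [b abP]]; apply: nab; exists a; rewrite env_holds_DEx; exists b;
      apply/bodyP.
  by move=> [a]; rewrite env_holds_DEx => -[b /bodyP abP]; apply: nab; exists a, b.
have -> : env_holds (b .: a .: x .: e)
    (FAnd (FLt (TVar 1) (TVar 2)) (FAnd (FLt (TVar 2) (TVar 0))
    (rename (reindex [:: 0; 1]%N 3) (FAnd (FOnItv E)
      (FBigAnd (map (fun H => FOr (FConstOn H) (FNowhereConst H)) Hs)))))) <->
  (a < x /\ x < b /\ env_holds (b .: a .: e) (FAnd (FOnItv E)
      (FBigAnd (map (fun H => FOr (FConstOn H) (FNowhereConst H)) Hs)))).
  set G := FAnd (FOnItv _) _.
  have GE : env_holds (b .: a .: x .: e) (rename (reindex [:: 0; 1]%N 3) G) <->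
    env_holds (b .: a .: e) G by reindex_tac.
  by rewrite (holds_FAnd _ (FLt _ _)) (holds_FAnd _ (FLt _ _)) GE.
rewrite holds_FAnd holds_FOnItv holds_FBigAnd.
have -> : (forall f, List.In f (map (fun H => FOr (FConstOn H) (FNowhereConst H)) Hs) ->
     env_holds (b .: a .: e) f) <->
   (forall h, List.In h hs -> const_on a b h \/ nowhere_const a b h).
  rewrite -(defines_allP (P := fun H => env_holds (b .: a .: e)
    (FOr (FConstOn H) (FNowhereConst H))) Hhs); last first.
    by move=> H h HP; rewrite holds_FOr (holds_FConstOn _ _ HP) (holds_FNowhereConst _
      _ HP).
  split=> fP.
    by move=> H HH; apply: fP; apply/List.in_map_iff; exists H.
  by move=> f /List.in_map_iff[H [<- HH]]; apply: fP.
by split=> [[? [? []]]|[]].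
Qed.

Lemma holds_FConstValue e H h c : defines e H h ->
  env_holds (c .: e) (FConstValue H) <-> locally_constant_value h c.
Proof.
move=> HP; rewrite /FConstValue env_holds_DEx.
have HE a b x : env_holds (x .: b .: a .: c .: e) (rename (reindex [:: 3; 0]%N 4) H)
    <-> h x = c.
  have -> : h x = c <-> c = h x by split=> ->.
  by rewrite -HP; reindex_tac.
split=> -[a].
  rewrite env_holds_DEx => -[b /holds_FAnd[ab /env_holds_DAll cP]].
  by exists a, b; split=> // x ax xb; apply/HE/cP.
move=> [b [ab cP]]; exists a; rewrite env_holds_DEx; exists b.
by rewrite holds_FAnd env_holds_DAll; split=> // x /= ax xb; apply/HE/cP.
Qed.

Lemma holds_FBelow e P v : env_holds (v .: e) (FBelow P) <->
  exists2 u, u < v & env_holds (u .: e) P.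
Proof.
rewrite /FBelow env_holds_DEx.
have PE u : env_holds (u .: v .: e) (rename (reindex [:: 0]%N 2) P) <->
    env_holds (u .: e) P by reindex_tac.
by split=> -[u]; [case/holds_FAnd=> uv /PE; exists u|move=> uv uP; exists u;
  apply/holds_FAnd; split=> //; apply/PE].
Qed.

Definition is_min (P : R -> Prop) v := P v /\ ~ exists2 u, u < v & P u.

Lemma is_min_uniq (P : R -> Prop) u v : is_min P u -> is_min P v -> u = v.
Proof.
move=> [Pu nu] [Pv nv]; case: (ltgtP u v) => // uv.
  by case: nv; exists u.
by case: nu; exists v.
Qed.

Lemma holds_FMin e P v :
  env_holds (v .: e) (FMin P) <-> is_min (fun v => env_holds (v .: e) P) v.
Proof. by rewrite /is_min -holds_FBelow. Qed.

Lemma holds_FMinOr0 e P v : env_holds (v .: e) (FMinOr0 P) <->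
  is_min (fun v => env_holds (v .: e) P) v \/
  (~ exists u, is_min (fun v => env_holds (v .: e) P) u) /\ v = 0.
Proof.
rewrite -holds_FMin /FMinOr0 holds_FOr holds_FAnd holds_FNot env_holds_DEx.
have PE u : env_holds (u .: v .: e) (rename (reindex [:: 0]%N 2) (FMin P)) <->
    is_min (fun v => env_holds (v .: e) P) u by rewrite -holds_FMin; reindex_tac.
have -> // : (exists u, env_holds (u .: v .: e) (rename (reindex [:: 0]%N 2) (FMin P)))
   <-> exists u, is_min (fun v => env_holds (v .: e) P) u.
by split=> -[u /PE uP]; exists u.
Qed.

Lemma FMinOr0_fun e P : exists! v, env_holds (v .: e) (FMinOr0 P).
Proof.
have [[u um]|nm] := classic (exists u, is_min (fun v => env_holds (v .: e) P) u).
  exists u; split=> [|v]; first by apply/holds_FMinOr0; left.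
  by case/holds_FMinOr0 => [|[]]; [exact: is_min_uniq|case; exists u].
exists 0; split=> [|v]; first by apply/holds_FMinOr0; right.
by case/holds_FMinOr0 => [vm|[]] //; case: nm; exists v.
Qed.

Lemma exists_is_min (P : R -> Prop) (l : seq R) v :
  (forall u, P u -> u \in l) -> P v -> exists u, is_min P u.
Proof.
move: {2}(size l) (leqnn (size l)) => n; elim: n l P v => [|n IH] l P v sl Pl Pv.
  by case: l sl Pl => // _ /(_ v Pv).
have [[u uv Pu]|nv] := classic (exists2 u, u < v & P u); last by exists v.
have [w [[wv Pw] wmin]] : exists w, is_min (fun u => u < v /\ P u) w.
  apply: (IH (filter (fun u => u < v) l) _ u) => //; last first.
    by move=> w [wv Pw]; rewrite mem_filter wv Pl.
  rewrite size_filter -ltnS; apply: leq_trans sl.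
  rewrite -(count_predC (fun u => u < v) l) -addn1 leq_add2l -has_count.
  by apply/hasP; exists v; [exact: Pl|rewrite /= ltxx].
exists w; split=> // -[u' uw Pu']; apply: wmin; exists u' => //.
by split=> //; apply: lt_trans wv.
Qed.

(** Removing the least element shortens the list, so [v] becomes the least one after fewer than [N]
    removals. *)
Lemma FSelect_cover e P N (l : seq R) v :
  (forall u, env_holds (u .: e) P -> u \in l) -> (size l <= N)%N ->
  env_holds (v .: e) P -> exists2 r, (r < N)%N & env_holds (v .: e) (FSelect P r).
Proof.
elim: N P l => [|N IH] P l Pl sl Pv.
  by move: (Pl v Pv); case: l sl {Pl}.
have [u um] := exists_is_min Pl Pv.
have [vm|nvm] := classic (is_min (fun u => env_holds (u .: e) P) v).
  by exists 0%N => //; apply/holds_FMinOr0; left.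
have [|||r rN rP] := IH (FNonMin P) (filter (predC1 u) l).
- move=> w /holds_FAnd[Pw /holds_FBelow[y yw Py]].
  rewrite mem_filter /= Pl // andbT; apply/eqP => wu.
  by case: um => _; apply; exists y; rewrite -?wu.
- rewrite size_filter -ltnS; apply: leq_trans sl.
  rewrite -(count_predC (predC1 u) l) -addn1 leq_add2l -has_count.
  by apply/hasP; exists u; [apply: Pl; case: um|rewrite /= eqxx].
- apply/holds_FAnd; split=> //; apply/holds_FBelow; apply: NNPP => nb.
  by apply: nvm; split.
by exists r.+1 => //; rewrite /FSelect iterSr.
Qed.

(** A set without interior lies in the list of points where truth is not locally constant. So
    finitely many selectors, in a number computed from [P] alone, reach all its elements. *)
Lemma isolated_FSelect e P (D : R -> Prop) v :
  (forall u, env_holds (u .: e) P <-> D u) -> (forall u, ~ near D u) ->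
  D v -> exists2 r, (r < isolated_bound P)%N & env_holds (v .: e) (FSelect P r).
Proof.
move=> PD nD Dv; have [l sl lP] := env_holds_near_const e P.
apply: FSelect_cover sl _; last by apply/PD.
move=> u Pu; apply: contraT => /lP nu; case: (nD u).
by apply: near_sub nu => w wu; apply/PD/wu.
Qed.

Lemma holds_FConstSel e S H h a b : defines e H h ->
  env_holds (b .: a .: e) (FConstSel S H) <->
  exists c, env_holds (c .: e) S /\ on_itv a b (fun x => h x = c).
Proof.
move=> HP; rewrite /FConstSel env_holds_DEx.
have HE c x : env_holds (x .: c .: b .: a .: e) (rename (reindex [:: 1; 0]%N 4) H)
    <-> h x = c.
  have -> : h x = c <-> c = h x by split=> ->.
  by rewrite -HP; reindex_tac.
have SE c : env_holds (c .: b .: a .: e) (rename (reindex [:: 0]%N 3) S) <->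
    env_holds (c .: e) S by reindex_tac.
split=> -[c cP]; exists c; move: cP; rewrite holds_FAnd env_holds_DAll SE.
  by move=> [Sc cP]; split=> // x ax xb; apply/HE/cP.
by move=> [Sc cP]; split=> // x /= ax xb; apply/HE/cP.
Qed.

Lemma holds_FApplySel e S H h z : defines e H h ->
  env_holds (z .: e) (FApplySel S H) <->
  exists x, env_holds (x .: e) S /\ z = h x.
Proof.
move=> HP; rewrite /FApplySel env_holds_DEx.
have HE x : env_holds (x .: z .: e) (rename (reindex [:: 1; 0]%N 2) H) <-> z = h x.
  by rewrite -HP; reindex_tac.
have SE x : env_holds (x .: z .: e) (rename (reindex [:: 0]%N 2) S) <->
    env_holds (x .: e) S by reindex_tac.
by split=> -[x xP]; exists x; move: xP; rewrite holds_FAnd SE HE.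
Qed.

End FormulaSemantics.

(** * The elimination algorithm and its correctness *)

Definition FConstantValueSel (H : oformula) (r : nat) : oformula :=
  FSelect (FConstValue H) r.

(* b, a, e for the first component of each pair; z, e for the second ones *)
Fixpoint FChoices (Hs : seq oformula) : seq (oformula * seq oformula) :=
  if Hs is H :: Hs' then
    map (fun p => (FAnd (FNowhereConst H) p.1, p.2)) (FChoices Hs') ++
    flatten (map (fun r => map
        (fun p => (FAnd (FConstSel (FConstantValueSel H r) H) p.1,
                   FConstantValueSel H r :: p.2))
        (FChoices Hs'))
      (iota 0 (isolated_bound (FConstValue H))))
  else [:: (FTrue, [::])].

Definition FExceptionalSel (E : oformula) (Hs : seq oformula) (r : nat) : oformula :=
  FSelect (FExceptional E Hs) r.

(* A conjunction [E /\ g_1 notin F /\ ... /\ g_m notin F] is coded by the pair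
   [(E, [:: g_1; ...; g_m])], and a sequence of such pairs by their disjunction. *)
Definition eliminate (E : oformula) (Hs : seq oformula) : seq (oformula * seq
  oformula) :=
  map (fun r => (DEx (FAnd (FExceptionalSel E Hs r) E),
        FExceptionalSel E Hs r :: map (FApplySel (FExceptionalSel E Hs r)) Hs))
      (iota 0 (isolated_bound (FExceptional E Hs))) ++
  map (fun p => (DEx (DEx (FAnd (FLt (TVar 1) (TVar 0)) (FAnd (FOnItv E) p.1))), p.2))
      (FChoices Hs).

(** Each pass removes variable 0 from every conjunction separately, as existential quantifiers
    distribute over disjunctions. *)
Fixpoint eliminate_all (n : nat) (E : oformula) (Hs : seq oformula) :
    seq (oformula * seq oformula) :=
  if n is n'.+1 then flatten (map (fun p => eliminate_all n' p.1 p.2) (eliminate E Hs))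
  else [:: (E, Hs)].

Lemma In_cat (T : Type) (x : T) (s u : seq T) :
  List.In x (s ++ u) <-> List.In x s \/ List.In x u.
Proof. exact: List.in_app_iff. Qed.

Lemma In_map (T U : Type) (f : T -> U) (y : U) (s : seq T) :
  List.In y (map f s) <-> exists2 x, List.In x s & y = f x.
Proof.
elim: s => [|x s IH] /=; first by split=> // -[].
split=> [[<-|/IH[z zs yz]]|[z [<-|zs] yz]].
- by exists x; auto.
- by exists z; auto.
- by left.
- by right; apply/IH; exists z.
Qed.

Lemma In_flatten_map (T U : Type) (f : T -> seq U) (y : U) (s : seq T) :
  List.In y (flatten (map f s)) <-> exists2 x, List.In x s & List.In y (f x).
Proof.
elim: s => [|x s IH] /=; first by split=> // -[].
rewrite In_cat IH; split=> [[yx|[z zs yz]]|[z [<-|zs] yz]].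
- by exists x; auto.
- by exists z; auto.
- by left.
- by right; exists z.
Qed.

Lemma In_iota r m n : (m <= r < m + n)%N -> List.In r (iota m n).
Proof.
elim: n m => [|n IH] m; first by rewrite addn0; lia.
by move=> rm /=; have [->|mr] := eqVneq m r; [left|right; apply: IH; lia].
Qed.

(* Keeps unification from running quantifier elimination. *)
Opaque isolated_bound.

Section Elimination.
Variables (R : rcfType) (F : R -> Prop).
Hypothesis FP : proper_subfield F.
Implicit Types (e : nat -> R) (E H S g : oformula) (Hs : seq oformula).

Definition value_notin e g := exists z, env_holds (z .: e) g /\ ~ F z.

Definition is_function e g := exists! z, env_holds (z .: e) g.

Definition conj_holds e (p : oformula * seq oformula) :=
  env_holds e p.1 /\ forall g, List.In g p.2 -> value_notin e g.

Definition disj_holds e (ps : seq (oformula * seq oformula)) :=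
  exists2 p, List.In p ps & conj_holds e p.

Definition all_functions e (ps : seq (oformula * seq oformula)) :=
  forall p, List.In p ps -> forall g, List.In g p.2 -> is_function e g.

Lemma defines_tame e H h : defines e H h -> tame_fun h.
Proof.
move=> HP; split; first exact: definable_fun_algebraic HP.
exact: definable_fun_tame HP.
Qed.

(** A choice declares each function nowhere constant or equal to a selected locally constant value.
    That value depends on [e] but not on [a] and [b], so its avoidance of F can stay outside the
    quantifiers over the interval. *)
Lemma FChoicesP e Hs hs a b : a < b -> defines_all e Hs hs ->
  (exists2 p, List.In p (FChoices Hs) & env_holds (b .: a .: e) p.1 /\
     forall g, List.In g p.2 -> value_notin e g) <->
  (forall h, List.In h hs ->
     nowhere_const a b h \/ exists c, ~ F c /\ on_itv a b (fun x => h x = c)).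
Proof.
move=> ab; elim=> [|H h {}Hs {}hs HP _ IH].
  by split=> // _; exists (FTrue, [::]) => //=; left.
split.
  move=> [p /In_cat[/In_map[q qs ->]|/In_flatten_map[r _ /In_map[q qs ->]]]].
    move=> [/holds_FAnd[/(holds_FNowhereConst _ _ HP) nh qab] qF].
    by move=> g [<-|gs]; [left|move: g gs; apply/IH; exists q].
  move=> [/holds_FAnd[/(holds_FConstSel _ _ _ HP)[c [Sc hc]] qab] qF] g [<-|gs]; last
    first.
    by move: g gs; apply/IH; exists q => //; split=> // k kq; apply: qF; right.
  right; exists c; split=> //; have [z [Sz nFz]] := qF _ (or_introl erefl).
  (* A selector has a single value, so the constant [c] is the value known to lie outside F. *)
  have [y [_ yP]] := FMinOr0_fun e (iter r FNonMin (FConstValue H)).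
  by rewrite -(yP _ Sc) (yP _ Sz).
move=> hsP; have /IH[q qs [qab qF]] := fun (k : R -> R) kh => hsP k (or_intror kh).
have [nh|[c [nFc hc]]] := hsP h (or_introl erefl).
  exists (FAnd (FNowhereConst H) q.1, q.2).
    by apply/In_cat; left; apply/In_map; exists q.
  by split=> //; apply/holds_FAnd; split=> //; apply/(holds_FNowhereConst _ _ HP).
have [r rN rP] : exists2 r, (r < isolated_bound (FConstValue H))%N &
    env_holds (c .: e) (FConstantValueSel H r).
  apply: isolated_FSelect; first by move=> u; apply: holds_FConstValue HP.
    by move=> u; apply: locally_constant_value_isolated; apply: defines_tame HP.
  by exists a, b.
exists (FAnd (FConstSel (FConstantValueSel H r) H) q.1, FConstantValueSel H r :: q.2).
  apply/In_cat; right; apply/In_flatten_map; exists r; first exact: In_iota.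
  by apply/In_map; exists q.
split; last by move=> g [<-|/qF //]; exists c.
by apply/holds_FAnd; split=> //; apply/(holds_FConstSel _ _ _ HP); exists c.
Qed.

Lemma FChoices_functions e Hs : all_functions e (FChoices Hs).
Proof.
elim: Hs => [|H Hs IH] p; first by case=> [<-|].
move=> /In_cat[/In_map[q qs ->]|/In_flatten_map[r _ /In_map[q qs ->]]] g /=.
  exact: IH.
by case=> [<-|]; [exact: FMinOr0_fun|exact: IH].
Qed.

(** Choice turns functional formulas into actual functions, to which the results on tame functions
    apply. *)
Lemma exists_defines_all e Hs :
  (forall H, List.In H Hs -> forall x, is_function (x .: e) H) ->
  exists hs, defines_all e Hs hs.
Proof.
elim: Hs => [|H Hs IH] HsP; first by exists nil; constructor.
have [hs hsP] := IH (fun G GH => HsP G (or_intror GH)).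
have HP := HsP H (or_introl erefl).
exists ((fun x => proj1_sig (constructive_indefinite_description _ (HP x))) :: hs).
constructor=> // x z; case: constructive_indefinite_description => y [Hy yP] /=.
by split=> [/yP ->|->].
Qed.

Lemma defines_In_l e Hs hs H : defines_all e Hs hs -> List.In H Hs ->
  exists2 h, defines e H h & List.In h hs.
Proof.
elim=> //= G g {}Hs {}hs GP _ IH [<-|/IH[h HP hh]]; first by exists g; auto.
by exists h; auto.
Qed.

Lemma defines_In_r e Hs hs h : defines_all e Hs hs -> List.In h hs ->
  exists2 H, defines e H h & List.In H Hs.
Proof.
elim=> //= G g {}Hs {}hs GP _ IH [<-|/IH[H HP HH]]; first by exists G; auto.
by exists H; auto.
Qed.

Lemma eliminate_functions e E Hs :
  (forall H, List.In H Hs -> forall x, is_function (x .: e) H) ->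
  all_functions e (eliminate E Hs).
Proof.
move=> HsP p /In_cat[/In_map[r _ ->]|/In_map[q qs ->]] g; last exact:
  (FChoices_functions e qs).
case=> [<-|/In_map[H HH ->]]; first exact: FMinOr0_fun.
have [hs hsP] : exists hs, defines_all e [:: H] hs.
  by apply: exists_defines_all => G [<-|//]; apply: HsP.
inversion hsP as [|G h Hs' hs' HP]; subst.
have [s [sP s_uniq]] := FMinOr0_fun e (iter r FNonMin (FExceptional E Hs)).
exists (h s); split=> [|z]; first by apply/(holds_FApplySel _ _ HP); exists s; split.
by move=> /(holds_FApplySel _ _ HP)[x [/s_uniq <- ->]].
Qed.

(** [one_variable_step] in terms of formulas: selectors reach the exceptional points, and [FChoices]
    describes the intervals. *)
Lemma eliminateP e E Hs :
  (forall H, List.In H Hs -> forall x, is_function (x .: e) H) ->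
  (exists2 x, ~ F x & conj_holds (x .: e) (E, Hs)) <-> disj_holds e (eliminate E Hs).
Proof.
move=> /exists_defines_all[hs hsP].
have hs_notin x : (forall g, List.In g Hs -> value_notin (x .: e) g) <->
    (forall h, List.In h hs -> ~ F (h x)).
  apply: (defines_allP hsP) => H h HP; split; first by move=> [z [/HP ->]].
  by move=> nF; exists (h x); split=> //; apply/HP.
have hs_tame h : List.In h hs -> tame_fun h.
  move: h; apply/(defines_allP (P := fun=> True) hsP); last by [].
  by move=> H h /defines_tame hT; split.
have step := one_variable_step (fun x => env_holds (x .: e) E) FP hs_tame.
have itvP : (exists a b, [/\ a < b, on_itv a b (fun x => env_holds (x .: e) E) &
    forall h, List.In h hs -> nowhere_const a b h \/
      exists c, ~ F c /\ on_itv a b (fun x => h x = c)]) <->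
    disj_holds e (map (fun p => (DEx (DEx (FAnd (FLt (TVar 1) (TVar 0))
      (FAnd (FOnItv E) p.1))), p.2)) (FChoices Hs)).
  split.
    move=> [a [b [ab Eab /(FChoicesP ab hsP)[p pC [pab pF]]]]].
    exists (DEx (DEx (FAnd (FLt (TVar 1) (TVar 0)) (FAnd (FOnItv E) p.1))), p.2).
      by apply/In_map; exists p.
    split=> //; apply/env_holds_DEx; exists a; apply/env_holds_DEx; exists b.
    by rewrite !holds_FAnd holds_FOnItv.
  move=> [_ /In_map[p pC ->]] [/env_holds_DEx[a /env_holds_DEx[b]]].
  rewrite !holds_FAnd holds_FOnItv => -[ab [Eab pab]] pF.
  by exists a, b; split=> //; apply/(FChoicesP ab hsP); exists p.
split.
  move=> [x nFx [Ex /hs_notin hx]].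
  have /step[[y [Ty nFy Ey hy]]|] : exists x, [/\ ~ F x, env_holds (x .: e) E &
    forall h, List.In h hs -> ~ F (h x)] by exists x.
    have [r rN rP] : exists2 r, (r < isolated_bound (FExceptional E Hs))%N &
        env_holds (y .: e) (FExceptionalSel E Hs r).
      apply: isolated_FSelect Ty; first by move=> u; apply: holds_FExceptional.
      exact: exceptional_isolated.
    eexists; first by apply/In_cat; left; apply/In_map; exists r => //; apply: In_iota.
    split; first by apply/env_holds_DEx; exists y; apply/holds_FAnd.
    move=> g [<-|/In_map[H HH ->]]; first by exists y.
    have [h HP hh] : exists2 h, defines e H h & List.In h hs by apply: defines_In_l HH.
    exists (h y); split; last exact: hy.
    by apply/(holds_FApplySel _ _ HP); exists y.
  by move/itvP => [p pI pP]; exists p => //; apply/In_cat; right.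
move=> [p /In_cat[pT|pI] pP]; last first.
  have /itvP ab : disj_holds e (map (fun p => (DEx (DEx (FAnd (FLt (TVar 1) (TVar 0))
      (FAnd (FOnItv E) p.1))), p.2)) (FChoices Hs)) by exists p.
  have [x [nFx Ex /hs_notin hx]] := proj2 step (or_intror ab).
  by exists x.
(* The selected point may be the default 0 and not exceptional; it still serves as a witness, since
   [E] and all avoidance conditions are asserted at it. *)
move: pT pP => /In_map[r _ ->] [/env_holds_DEx[x /holds_FAnd[Sx Ex]] pF].
have [y [_ S_uniq]] := FMinOr0_fun e (iter r FNonMin (FExceptional E Hs)).
have [z [Sz nFz]] := pF _ (or_introl erefl).
exists x; first by rewrite -(S_uniq _ Sx) (S_uniq _ Sz).
split=> //; apply/hs_notin => h hh.
have [H HP HH] := defines_In_r hsP hh.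
have [t [/(holds_FApplySel _ _ HP)[x' [Sx' ->]]]] : value_notin e (FApplySel
  (FExceptionalSel E Hs r) H).
  by apply: pF; right; apply/In_map; exists H.
by rewrite -(S_uniq _ Sx) (S_uniq _ Sx').
Qed.

End Elimination.

(* Inverse of [cycle_down]: in [Defs] the value of a function of m arguments is
   variable m, here it is variable 0. *)
Definition cycle_up (m i : nat) : nat :=
  if (i < m)%N then i.+1 else if i == m then 0%N else i.

Lemma cycle_up_inj m : injective (cycle_up m).
Proof.
move=> i j; rewrite /cycle_up.
by case: (ltngtP i m) => im; case: (ltngtP j m) => jm; lia.
Qed.

Fixpoint pbc_of_disj (k : nat) (ps : seq (oformula * seq oformula)) : pbc :=
  if ps is p :: ps' then
    POr (foldr (fun g q => PAnd (PG (rename (cycle_down k) g)) q) (PD p.1) p.2)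
        (pbc_of_disj k ps')
  else PD FFalse.

(** * Several variables, and the return to the original presentations *)

Section ManyVariables.
Variables (R : rcfType) (F : R -> Prop).
Hypothesis FP : proper_subfield F.
Implicit Types (e : nat -> R) (E H g : oformula) (Hs : seq oformula).

(** The head of [s] is eliminated first. The induction hypothesis then applies to each resulting
    conjunction, whose formulas are again functional by [eliminate_functions]. *)
Lemma eliminate_allP n e E Hs :
  (forall s : seq R, size s = n ->
     forall H, List.In H Hs -> is_function (foldr (@scons R) e s) H) ->
  all_functions e (eliminate_all n E Hs) /\
  ((exists s : seq R, [/\ size s = n, forall x, x \in s -> ~ F x &
     conj_holds F (foldr (@scons R) e s) (E, Hs)]) <->
   disj_holds F e (eliminate_all n E Hs)).
Proof.
elim: n E Hs => [|n IH] E Hs HsP.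
  split; first by move=> p [<-|[]] g /(HsP [::] erefl).
  split; first by move=> [s [/size0nil -> _ EP]]; exists (E, Hs) => //; left.
  by move=> [p [<-|[]] EP]; exists [::].
have step s : size s = n -> forall H, List.In H Hs ->
    forall x, is_function (x .: foldr (@scons R) e s) H.
  by move=> sn H HH x; apply: (HsP (x :: s)) => //=; rewrite sn.
have IHp p : List.In p (eliminate E Hs) -> _ := fun pI => IH p.1 p.2
  (fun s sn => @eliminate_functions R (foldr (@scons R) e s) E Hs (step s sn) p pI).
split; first by move=> p /In_flatten_map[q qI pq]; apply: (proj1 (IHp q qI)).
split.
  move=> [[|x s] [sn xsF EP]] //; case: sn => sn.
  have /(eliminateP FP _ (step s sn))[p pI pP] :
      exists2 x, ~ F x & conj_holds F (x .: foldr (@scons R) e s) (E, Hs).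
    by exists x => //; apply: xsF; rewrite mem_head.
  have /(proj2 (IHp p pI))[q qI qP] : exists s : seq R, [/\ size s = n,
      forall x, x \in s -> ~ F x & conj_holds F (foldr (@scons R) e s) p].
    by exists s; split=> // y ys; apply: xsF; rewrite inE ys orbT.
  by exists q => //; apply/In_flatten_map; exists p.
move=> [q /In_flatten_map[p pI qI] qP].
have /(proj2 (IHp p pI))[s [sn sF pP]] : disj_holds F e (eliminate_all n p.1 p.2).
  by exists q.
have /(eliminateP FP _ (step s sn))[x nFx EP] :
    disj_holds F (foldr (@scons R) e s) (eliminate E Hs) by exists p.
exists (x :: s); split=> //=; first by rewrite sn.
by move=> y; rewrite inE => /orP[/eqP ->|/sF].
Qed.

Lemma foldr_scons_nth (s t : seq R) i : foldr (@scons R) (nth 0 t) s i = (s ++ t)`_i.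
Proof. by elim: s i => //= x s IH [|i] //=. Qed.

Lemma holds_cycle_up e (v : seq R) z H : (forall i, e i = v`_i) ->
  env_holds (z .: e) (rename (cycle_up (size v)) H) <-> holds (v ++ [:: z]) H.
Proof.
move=> ev; rewrite (env_holds_rename _ (@cycle_up_inj _) (e' := nth 0 (v ++ [:: z]))).
  by rewrite -(@env_holds_seq R _ (v ++ [:: z])).
move=> i; rewrite /cycle_up nth_cat; case: (ltngtP i (size v)) => iv /=.
- by rewrite ev.
(* Beyond the value variable both environments return the default 0. *)
- case: i iv => // i iv /=; rewrite ev [RHS]nth_default // nth_default //=.
  by rewrite subn_gt0.
- by rewrite iv subnn.
Qed.

Lemma holds_cycle_down (y : seq R) z g :
  holds (y ++ [:: z]) (rename (cycle_down (size y)) g) <-> env_holds (z .: nth 0 y) g.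
Proof.
rewrite (@env_holds_seq R (nth 0 (y ++ [:: z]))) //.
apply: env_holds_rename; first exact: cycle_down_inj.
move=> [|i] /=; first by rewrite nth_cat ltnn subnn.
case: ltnP => iy; first by rewrite nth_cat iy.
by rewrite !nth_default // size_cat addn1.
Qed.

Lemma pbc_of_disj_holds (y : seq R) ps :
  pbc_holds F y (pbc_of_disj (size y) ps) <-> disj_holds F (nth 0 y) ps.
Proof.
elim: ps => [|[D gs] ps IH] /=; first by split=> // -[].
have DE : holds y D <-> env_holds (nth 0 y) D by apply: env_holds_seq.
have -> : pbc_holds F y (foldr (fun g q =>
    PAnd (PG (rename (cycle_down (size y)) g)) q) (PD D) gs) <->
    conj_holds F (nth 0 y) (D, gs).
  elim: gs => [|g gs IHg] /=; first by rewrite DE; split=> // -[].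
  have gE : fun_notin F y (rename (cycle_down (size y)) g) <-> value_notin F (nth 0 y)
    g.
    by split=> -[z [gz nFz]]; exists z; split=> //; move: gz; rewrite holds_cycle_down.
  rewrite gE IHg; split=> [[gN [Dy gsN]]|[Dy gsN]].
    by split=> // k [<-|/gsN].
  split; first by apply: gsN; left.
  by split=> // k kI; apply: gsN; right.
rewrite IH; split=> [[DgP|[p pI pP]]|[p [<-|pI] pP]].
- by exists (D, gs) => //; left.
- by exists p => //; right.
- by left.
- by right; exists p.
Qed.

Lemma pbc_of_disj_wf k ps :
  (forall v : k.-tuple R, all_functions (nth 0 v) ps) ->
  pbc_wf R k (pbc_of_disj k ps).
Proof.
elim: ps => //= -[D gs] ps IH psP; split; last first.
  by apply: IH => v p pI; apply: psP; right.
have {psP} : forall g, List.In g gs -> forall v : k.-tuple R, is_function (nth 0 v) g.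
  by move=> g gI v; apply: (psP v (D, gs)) => //; left.
elim: gs => //= g gs IHg gsP; split; last by apply: IHg => h hI; apply: gsP; right.
move=> v; have [z [gz z_uniq]] := gsP g (or_introl erefl) v.
have gE t : holds (v ++ [:: t]) (rename (cycle_down k) g) <-> env_holds (t .: nth 0 v)
  g.
  by have := holds_cycle_down v t g; rewrite size_tuple.
by exists z; split=> [|t]; [apply/gE|move/gE/z_uniq].
Qed.

End ManyVariables.

Theorem theorem7p5 :
  { A : nat -> nat -> oformula -> seq oformula -> pbc |
    forall (R : rcfType) (F : R -> Prop) (n k : nat)
           (E : oformula) (hs : seq oformula),
      proper_subfield F ->
      (forall h, List.In h hs -> presents_function R (n + k) h) ->
      pbc_wf R k (A n k E hs) /\
      forall y : k.-tuple R,
        (exists x : n.-tuple R,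
            (forall i : 'I_n, ~ F (tnth x i)) /\
            holds (x ++ y) E /\
            (forall h, List.In h hs -> fun_notin F (x ++ y) h))
        <-> pbc_holds F y (A n k E hs) }.
Proof.
(* The witness is built from [n], [k], [E] and [hs] alone, so it is independent of [R] and F.
   [cycle_up] moves the value variable of each function from index n+k to index 0. *)
exists (fun n k E hs =>
  pbc_of_disj k (eliminate_all n E (map (rename (cycle_up (n + k))) hs))).
move=> R F n k E hs FP hsP.
have hE (x : n.-tuple R) (y : k.-tuple R) z h :
    env_holds (z .: foldr (@scons R) (nth 0 y) x) (rename (cycle_up (n + k)) h) <->
    holds ((x ++ y) ++ [:: z]) h.
  rewrite -(holds_cycle_up _ _ (foldr_scons_nth x y)).
  by rewrite size_cat !size_tuple.
have hs_fun (y : k.-tuple R) (s : seq R) : size s = n ->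
    forall H, List.In H (map (rename (cycle_up (n + k))) hs) ->
    is_function (foldr (@scons R) (nth 0 y) s) H.
  move=> sn _ /In_map[h hI ->]; have xyP : size (s ++ y) == (n + k)%N.
    by rewrite size_cat sn size_tuple.
  have [z [hz z_uniq]] := hsP h hI (Tuple xyP).
  exists z; split=> [|t]; first by apply/(hE (Tuple (introT eqP sn))).
  by move/(hE (Tuple (introT eqP sn)))/z_uniq.
split; first by apply: pbc_of_disj_wf => y; case: (eliminate_allP FP E (hs_fun y)).
move=> y; have := pbc_of_disj_holds F y
  (eliminate_all n E (map (rename (cycle_up (n + k))) hs)).
rewrite size_tuple => ->; have [_ <-] := eliminate_allP FP E (hs_fun y).
have EE (x : n.-tuple R) : holds (x ++ y) E <-> env_holds (foldr (@scons R) (nth 0 y)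
  x) E.
  by apply: env_holds_seq => i _; rewrite foldr_scons_nth.
have hsE (x : n.-tuple R) : (forall h, List.In h hs -> fun_notin F (x ++ y) h) <->
    (forall g, List.In g (map (rename (cycle_up (n + k))) hs) ->
       value_notin F (foldr (@scons R) (nth 0 y) x) g).
  split=> hsN g.
    by move=> /In_map[h /hsN[z [hz nFz]] ->]; exists z; split=> //; apply/hE.
  move=> gI; have [|z [/hE hz nFz]] := hsN (rename (cycle_up (n + k)) g).
    by apply/In_map; exists g.
  by exists z.
split.
  move=> [x [xF [/EE Ex /hsE hx]]]; exists x; split=> //; first exact: size_tuple.
  by move=> _ /tnthP[i ->].
move=> [s [sn sF [Es hs_s]]]; pose x := Tuple (introT eqP sn).
exists x; split; first by move=> i; apply: sF; exact: (mem_tnth i x).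
by split; [apply/EE|apply/hsE].
Qed.
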